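(* Let $n\ge 3$, let $x_1,\dots,x_n\in X$ and $y=(y_1,\dots,y_n)\in\mathbb{R}^n$. Consider the prior random field $Y_x=U+VW_x$ ($x\in X$), where $U$ is a real random variable uniformly distributed on $[-m,m]$, $V$ is a real positive random variable uniformly distributed on $[\varepsilon,1/\varepsilon]$, $(W_x)_{x\in X}$ is a centered normalized (mean $0$, variance $1$) Gaussian field with correlation function $k$, and $U$, $V$ and $(W_x)_{x\in X}$ are independent. The conditional distribution of the random field $(Y_x)_{x\in X}$ knowing that $Y_{x_i}=y_i$ for $1\le i\le n$ is given by explicit formulae of densities of finite dimensional marginals. When the parameter $m$ goes to infinity and $\varepsilon$ goes to zero, for $n>2$, this conditional distribution becomes a multivariate Student distribution. In particular, when $m\to\infty$, $\varepsilon\to0$ and $n>2$, the univariate conditional distribution of the random variable $Y_x$ becomes a Student distribution with $n-2$ degrees of freedom, with location parameter $$\mu+k(x)\Sigma^{-1}(y-\mu\mathbf 1)^T\quad\text{with}\quad \mu:=\frac{y\Sigma^{-1}\mathbf 1^T}{\mathbf 1\Sigma^{-1}\mathbf 1^T},$$ and scale parameter $$\sqrt{\frac1{n-2}\Big((y-\mu\mathbf 1)\Sigma^{-1}y^T\Big)\left(1-k(x)\Sigma^{-1}k(x)^T+\frac{\big(1-\mathbf 1\Sigma^{-1}k(x)^T\big)^2}{\mathbf 1\Sigma^{-1}\mathbf 1^T}\right)},$$ where $\mathbf 1=(1,1,\dots,1)\in\mathbb{R}^n$.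
   Context: $X\subseteq\mathbb{R}^D$ is the index set (factor space). Vectors are row vectors. The correlation function $k:X\times X\to\mathbb{R}$ of the centered normalized Gaussian field $(W_x)_{x\in X}$ satisfies $\mathrm{cov}(W_x,W_{x'})=k(x,x')$ and $k(x,x)=1$ for all $x,x'\in X$. $\Sigma=(k(x_i,x_j))_{1\le i,j\le n}$ is the positive-definite matrix of correlations and $k(x)=(k(x,x_j))_{1\le j\le n}$ is the correlation vector. Throughout, particular choices of the correlation $k$, of the points $x_1,\dots,x_n$ and of the numbers $y_1,\dots,y_n$ which could lead to degenerate distributions are excluded. A $p$-variate Student distribution with $\nu$ degrees of freedom ($\nu$ a positive integer), location vector $\lambda\in\mathbb{R}^p$ and positive-definite $p\times p$ matrix of scale parameters $S$ has density $$t\mapsto\frac{1}{(\sqrt{\pi\nu})^p\sqrt{|S|}}\,\frac{\Gamma(\frac{\nu+p}2)}{\Gamma(\frac\nu2)}\Big(1+\frac1\nu(t-\lambda)S^{-1}(t-\lambda)^T\Big)^{-\frac{\nu+p}2},\qquad t\in\mathbb{R}^p.$$ In the univariate case $p=1$, a scale parameter $s$ corresponds to $S=s^2$. *)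

(* Defs.v *)
From HB Require Import structures.
From mathcomp Require Import all_boot all_order all_algebra.
From mathcomp Require Import all_classical all_reals all_analysis.

Set Implicit Arguments.
Unset Strict Implicit.
Unset Printing Implicit Defensive.

Import Order.TTheory GRing.Theory Num.Theory.
Import numFieldNormedType.Exports.

Local Open Scope classical_set_scope.
Local Open Scope ring_scope.

(* R^q occurs in two forms: 'rV[R]_q for linear algebra and topology, and
   q.-tuple for measure theory, where the library provides the product
   (Borel) sigma-algebra. [rV_of] converts from the latter to the former. *)
Notation tupleR R q := (q.-tuple (measurableTypeR R)).

Definition rV_of (R : realType) (q : nat) (t : tupleR R q) : 'rV[R]_q :=
  \row_i tnth t i.

(* Lebesgue measure on R^q, as the iterated product of the library's Lebesgue
   measure on R, transported along (x, t) |-> x :: t. *)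
Section lebesgue_measure_tuple.
Variable R : realType.

Definition consT (q : nat) (xt : measurableTypeR R * tupleR R q) :
  tupleR R q.+1 := [tuple of xt.1 :: xt.2].

Lemma measurable_consT q : measurable_fun setT (@consT q).
Proof. exact: measurable_cons. Qed.

Definition unconsT (q : nat) (t : tupleR R q.+1) :
  measurableTypeR R * tupleR R q := (thead t, [tuple of behead t]).

Lemma measurable_unconsT q : measurable_fun setT (@unconsT q).
Proof.
apply/measurable_fun_pairP; split.
  exact: measurable_tnth.
exact: measurable_behead.
Qed.

Lemma consTK q : cancel (@consT q) (@unconsT q).
Proof. by case=> x t; congr pair; apply: val_inj. Qed.

Lemma unconsTK q : cancel (@unconsT q) (@consT q).
Proof. by move=> t; rewrite [RHS]tuple_eta. Qed.

Section lebesgue_consT.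
Variables (q : nat) (mu : {sigma_finite_measure set (tupleR R q) -> \bar R}).

Definition lebesgue_consT : set (tupleR R q.+1) -> \bar R :=
  pushforward (lebesgue_measure \x mu)%E (@consT q).

Let lebesgue_consT0 : lebesgue_consT set0 = 0%E.
Proof. by rewrite /lebesgue_consT /pushforward preimage_set0 measure0. Qed.

Let lebesgue_consT_ge0 A : (0 <= lebesgue_consT A)%E.
Proof. exact: (measure_ge0 (lebesgue_measure \x mu)%E). Qed.

Let lebesgue_consT_sigma_additive : semi_sigma_additive lebesgue_consT.
Proof.
move=> F mF tF mUF; rewrite /lebesgue_consT /pushforward preimage_bigcup.
have mcF n : measurable (@consT q @^-1` F n).
  by rewrite -[X in measurable X]setTI; exact: measurable_consT.
apply: measure_semi_sigma_additive => //.
- apply/trivIsetP => /= i j _ _ ij; rewrite -preimage_setI.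
  by move/trivIsetP : tF => /(_ _ _ _ _ ij) ->//; rewrite preimage_set0.
- exact: bigcupT_measurable.
Qed.

HB.instance Definition _ := isMeasure.Build _ _ _ lebesgue_consT
  lebesgue_consT0 lebesgue_consT_ge0 lebesgue_consT_sigma_additive.

Let lebesgue_consT_sigma_finite : sigma_finite setT lebesgue_consT.
Proof.
have /sigma_finiteP[F [TF ndF Foo]] := sigma_finiteT (@lebesgue_measure R).
have /sigma_finiteP[G [TG ndG Goo]] := sigma_finiteT mu.
exists (fun n => @unconsT q @^-1` (F n `*` G n)).
  rewrite -preimage_bigcup (_ : \bigcup_n _ = setT) ?preimage_setT//.
  rewrite -setXTT TF TG predeqE => -[x y]; split.
    by move=> [n _ []/= ? ?]; split; exists n.
  move=> [/= [n _ Fnx] [k _ Gky]]; exists (maxn n k) => //; split.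
  - by move: x Fnx; exact/subsetPset/ndF/leq_maxl.
  - by move: y Gky; exact/subsetPset/ndG/leq_maxr.
move=> n; have [mF Fnoo] := Foo n; have [mG Gnoo] := Goo n; split.
  by rewrite -[X in measurable X]setTI; apply: measurable_unconsT => //;
    exact: measurableX.
rewrite /lebesgue_consT /pushforward -comp_preimage.
rewrite (_ : _ \o _ = id); last by apply/funext => x /=; rewrite consTK.
by rewrite preimage_id product_measure1E// lte_mul_pinfty// ge0_fin_numE.
Qed.

HB.instance Definition _ := Measure_isSigmaFinite.Build _ _ _ lebesgue_consT
  lebesgue_consT_sigma_finite.

End lebesgue_consT.

Fixpoint lebesgue_tuple (q : nat) :
    {sigma_finite_measure set (tupleR R q) -> \bar R} :=
  if q is q'.+1 then lebesgue_consT (lebesgue_tuple q') else \d_[tuple].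

End lebesgue_measure_tuple.
Arguments lebesgue_tuple {R} q.

Section distributions.
Variable R : realType.

Definition posdefmx q (S : 'M[R]_q) : Prop :=
  S^T = S /\ forall z : 'rV_q, z != 0 -> 0 < (z *m S *m z^T) 0 0.

(* a S^{-1} b^T for row vectors a and b *)
Definition invform q (S : 'M[R]_q) (a b : 'rV[R]_q) : R :=
  (a *m invmx S *m b^T) 0 0.

Definition normal_density q (mean : 'rV[R]_q) (S : 'M[R]_q) (z : 'rV[R]_q) : R :=
  (Num.sqrt ((2 * pi) ^+ q * \det S))^-1 *
  expR (- invform S (z - mean) (z - mean) / 2).

Definition Gamma (a : R) : R :=
  \int[lebesgue_measure]_(x in `]0, +oo[) (x `^ (a - 1) * expR (- x)).

Definition student_density (nu p : nat) (loc : 'rV[R]_p) (S : 'M[R]_p)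
    (t : 'rV[R]_p) : R :=
  (Num.sqrt (pi * nu%:R) ^+ p * Num.sqrt (\det S))^-1 *
  (Gamma ((nu + p)%:R / 2) / Gamma (nu%:R / 2)) *
  (1 + nu%:R^-1 * invform S (t - loc) (t - loc)) `^ (- ((nu + p)%:R / 2)).

End distributions.

Section random_fields.
Variables (R : realType) (d : measure_display) (O : measurableType d).
Variable P : probability O R.

Definition has_density q (Z : 'I_q -> O -> R) (f : 'rV[R]_q -> R) : Prop :=
  [/\ measurable_fun setT (f \o @rV_of R q),
      forall z, 0 <= f z
    & forall A : set (tupleR R q), measurable A ->
        P [set w | A (mktuple (Z ^~ w))] =
        (\int[lebesgue_tuple q]_(t in A) (f (rV_of t))%:E)%E].

Definition uniform_rv (Z : {RV P >-> R}) (a b : R) : Prop :=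
  exists ab : a < b, forall A : set (measurableTypeR R), measurable A ->
    P (Z @^-1` A) = uniform_prob ab A.

Definition sigma_rv (Z : O -> R) : set_system O :=
  preimage_set_system setT Z measurable.

Definition sigma_field T (X : set T) (W : T -> O -> R) : set_system O :=
  <<s \bigcup_(x in X) sigma_rv (W x) >>.

Definition independent3 (F G H : set_system O) : Prop :=
  forall A B C, F A -> G B -> H C -> P (A `&` B `&` C) = (P A * P B * P C)%E.

End random_fields.

Section model.
Variables (R : realType) (D : nat).
Local Notation point := 'rV[R]_D.
Variables (X : set point) (k : point -> point -> R).

Definition corr_mx p q (a : 'I_p -> point) (b : 'I_q -> point) : 'M[R]_(p, q) :=
  \matrix_(i, j) k (a i) (b j).

Definition cat_pts p q (a : 'I_p -> point) (b : 'I_q -> point)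
    (i : 'I_(p + q)) : point :=
  match fintype.split i with inl i1 => a i1 | inr i2 => b i2 end.

Section field.
Variables (d : measure_display) (O : measurableType d) (P : probability O R).

(* Centered Gaussian field on X with covariance k. The last clause gives the
   law of the finite-dimensional marginals with nonsingular covariance; the
   covariance clause determines the others, since it makes the components of
   any marginal almost surely linear combinations of the components of a
   nonsingular one. *)
Definition gaussian_field (W : point -> {RV P >-> R}) : Prop :=
  [/\ forall x, X x -> ('E_P[W x] = 0)%E,
      forall x x', X x -> X x' -> covariance P (W x) (W x') = (k x x')%:E
    & forall q (a : 'I_q -> point), (forall i, X (a i)) ->
        posdefmx (corr_mx a a) ->
        has_density P (fun i => W (a i)) (normal_density 0 (corr_mx a a))].

Definition prior_model (m e : R) (U V : {RV P >-> R})
    (W : point -> {RV P >-> R}) : Prop :=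
  [/\ uniform_rv U (- m) m,
      uniform_rv V e e^-1,
      gaussian_field W
    & independent3 P (sigma_rv U) (sigma_rv V) (sigma_field X W)].

Definition prior_field (U V : {RV P >-> R}) (W : point -> {RV P >-> R})
    (x : point) (w : O) : R := U w + V w * W x w.

(* g is the density of (Y_{a_1}, ..., Y_{a_p}) conditionally on
   (Y_{b_1}, ..., Y_{b_n}) = y, that is f(., y) / h(y) with f and h the joint
   and marginal densities. As the conditioning event has probability zero, the
   versions matter: f and h are the continuous ones, which are unique. *)
Definition cond_density (Y : point -> O -> R) p (a : 'I_p -> point)
    n (b : 'I_n -> point) (y : 'rV[R]_n) (g : 'rV[R]_p -> R) : Prop :=
  exists (f : 'rV[R]_(p + n) -> R) (h : 'rV[R]_n -> R),
    [/\ continuous f /\ has_density P (fun i => Y (cat_pts a b i)) f,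
        continuous h /\ has_density P (fun i => Y (b i)) h,
        0 < h y
      & forall t, g t = f (row_mx t y) / h y].

End field.

(* Density of a marginal of U + V W with correlation matrix S: the normal
   density with mean (u, ..., u) and covariance v^2 S, averaged over the
   uniform laws of u in [-m, m] and v in [e, 1/e]. *)
Definition prior_density (m e : R) q (S : 'M[R]_q) (z : 'rV[R]_q) : R :=
  (2 * m)^-1 * (e^-1 - e)^-1 *
  \int[lebesgue_measure]_(v in `[e, e^-1])
    \int[lebesgue_measure]_(u in `[- m, m])
      normal_density (const_mx u) (v ^+ 2 *: S) z.

Definition posterior_density n (xs : 'I_n -> point) (y : 'rV[R]_n)
    p (a : 'I_p -> point) (m e : R) (t : 'rV[R]_p) : R :=
  prior_density m e (corr_mx (cat_pts a xs) (cat_pts a xs)) (row_mx t y) /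
  prior_density m e (corr_mx xs xs) y.

(* As m -> +oo and e -> 0+ jointly, the distributions on R^p with densities
   g m e converge to a Student distribution: pointwise convergence of the
   densities, and convergence of the probability of every Borel set. *)
Definition becomes_student p (g : R -> R -> 'rV[R]_p -> R)
    (nu : nat) (loc : 'rV[R]_p) (S : 'M[R]_p) : Prop :=
  [/\ (0 < nu)%N,
      posdefmx S,
      forall t, g me.1 me.2 t @[me --> (+oo, 0^'+)] -->
        student_density nu loc S t
    & forall A : set (tupleR R p), measurable A ->
        (\int[lebesgue_tuple p]_(t in A) (g me.1 me.2 (rV_of t))%:E)%E
          @[me --> (+oo, 0^'+)] -->
        (\int[lebesgue_tuple p]_(t in A)
          (student_density nu loc S (rV_of t))%:E)%E].

Section univariate.
Variables (n : nat) (xs : 'I_n -> point) (y : 'rV[R]_n) (x : point).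
Let Sigma := corr_mx xs xs.
Let kx : 'rV[R]_n := \row_j k x (xs j).
Let one : 'rV[R]_n := const_mx 1.

Definition krig_mean : R := invform Sigma y one / invform Sigma one one.

Definition krig_loc : R :=
  krig_mean + invform Sigma kx (y - krig_mean *: one).

Definition krig_scale : R :=
  Num.sqrt ((n - 2)%:R^-1 * invform Sigma (y - krig_mean *: one) y *
    (1 - invform Sigma kx kx +
     (1 - invform Sigma one kx) ^+ 2 / invform Sigma one one)).

End univariate.
End model.

(* Main.v *)
(* For a positive definite S of size q, put c = 1 S^-1 1^T and let r(z) be the
   minimum over u of (z - u 1) S^-1 (z - u 1)^T, attained at u = b. The normal
   density with mean u 1 and covariance v^2 S is proportional to
   v^-q exp (- (c (u - b)^2 + r(z)) / (2 v^2)). Integrating over u (a Gaussian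
   integral) and then over v > 0 (by the substitution x = r(z) / (2 v^2)) leaves
   a constant times Gamma ((q - 2) / 2) r(z)^(- (q - 2) / 2). The domains of
   (v, u) increase with m and 1 / e, so the prior densities, freed of their
   normalization (which cancels in the posterior), converge by monotone
   convergence, both pointwise and after integration over a Borel set.
   Eliminating the observed block gives
   r(t, y) = r(y) + (t - loc) M^-1 (t - loc)^T, where M is the Schur complement
   of Sigma plus a rank-one term, and the quotient of the two limits is the
   Student density with scale matrix (r(y) / (n - 2)) M.
   For fixed m and e, independence makes the law of (U, (V, W)) a product, and
   the affine substitution t = u 1 + v w with Tonelli's theorem identifies the
   mixture as the density of the marginals of U + V W. *)
Require Import Defs.
From HB Require Import structures.
From mathcomp Require Import all_boot all_order all_algebra.
From mathcomp Require Import all_classical all_reals all_analysis.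
From mathcomp Require Import measurable_realfun.
From mathcomp Require Import ring lra.

Set Implicit Arguments.
Unset Strict Implicit.
Unset Printing Implicit Defensive.

Import Order.TTheory GRing.Theory Num.Theory.
Import numFieldNormedType.Exports.

Local Open Scope classical_set_scope.
Local Open Scope ring_scope.

(** * Kriging and Schur complements *)

(** The limit is taken along the product of the filters of m -> +oo and e -> 0+, whereas monotone
    convergence is a statement about sequences. As the unnormalized densities increase in m and in
    1/e, their limit can be read off on the diagonal m = n + 1, e = 1/(n + 1); one squeeze argument
    serves both the densities and their integrals over a Borel set. With k = n - 2, integrating over
    u leaves v^-(k+1) exp (- r(y) / (2 v^2)). Its integral is finite because r(y) > 0, for y is not
    constant, so that the exponential beats the power near 0, and because k > 0, so that the power
    is integrable at infinity. Integrals stay extended-real-valued as long as possible; the real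
    integrals of the definitions are recovered through finiteness for fixed m and e. The constants
    of the two limits match through the identity det T (1 T^-1 1^T) = det M det Sigma (1 Sigma^-1
    1^T), with T the correlation matrix of all the points. Since conditional densities are defined
    from continuous versions, the mixtures must also be shown continuous; this comes from a
    Lipschitz bound on the kernel, uniform over the rectangle of (v, u). *)

Section linear_algebra.
Variable R : realType.

Lemma mulmx_tr11 q (a b : 'rV[R]_q) : (a *m b^T) 0 0 = (b *m a^T) 0 0.
Proof. by rewrite -[b in RHS]trmxK -trmx_mul [RHS]mxE. Qed.

Section invform.
Variables (q : nat) (S : 'M[R]_q).
Implicit Types a b : 'rV[R]_q.

Lemma invformDl a a' b : invform S (a + a') b = invform S a b + invform S a' b.
Proof. by rewrite /invform !mulmxDl mxE. Qed.

Lemma invformDr a b b' : invform S a (b + b') = invform S a b + invform S a b'.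
Proof. by rewrite /invform linearD /= mulmxDr mxE. Qed.

Lemma invformZl x a b : invform S (x *: a) b = x * invform S a b.
Proof. by rewrite /invform -!scalemxAl mxE. Qed.

Lemma invformZr x a b : invform S a (x *: b) = x * invform S a b.
Proof. by rewrite /invform linearZ /= -scalemxAr mxE. Qed.

Lemma invformNl a b : invform S (- a) b = - invform S a b.
Proof. by rewrite -scaleN1r invformZl mulN1r. Qed.

Lemma invformNr a b : invform S a (- b) = - invform S a b.
Proof. by rewrite -scaleN1r invformZr mulN1r. Qed.

Lemma invformC a b : S^T = S -> invform S a b = invform S b a.
Proof.
by move=> St; rewrite /invform mulmx_tr11 trmx_mul trmx_inv St mulmxA.
Qed.

Lemma invform_scale x a b : x != 0 -> S \in unitmx ->
  invform (x *: S) a b = x^-1 * invform S a b.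
Proof.
move=> x0 Su; rewrite /invform invmxZ ?unitmxZ ?unitfE//.
by rewrite -scalemxAr -scalemxAl mxE.
Qed.

Lemma posdef_unit : posdefmx S -> S \in unitmx.
Proof.
move=> [_ Spos]; rewrite unitmxE unitfE; apply/det0P => -[v v0 vS].
by have := Spos v v0; rewrite vS mul0mx mxE ltxx.
Qed.

Lemma invform_gt0 a : posdefmx S -> a != 0 -> 0 < invform S a a.
Proof.
move=> Spd a0; have Su := posdef_unit Spd; case: (Spd) => St Spos.
have aS0 : a *m invmx S != 0.
  by apply: contra_neq a0 => aS; rewrite -(mulmxKV Su a) aS mul0mx.
by have := Spos _ aS0; rewrite mulmxKV// trmx_mul trmx_inv St mulmxA.
Qed.

Lemma invform_ge0 a : posdefmx S -> 0 <= invform S a a.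
Proof.
move=> Spd; have [->|a0] := eqVneq a 0; last exact/ltW/invform_gt0.
by rewrite /invform !mul0mx mxE.
Qed.

Lemma posdef_scale x : 0 < x -> posdefmx S -> posdefmx (x *: S).
Proof.
move=> x0 [St Spos]; split; first by rewrite linearZ /= St.
by move=> z z0; rewrite -scalemxAr -scalemxAl mxE mulr_gt0// Spos.
Qed.

End invform.

(** Invariance under a change of basis, used with the triangular factor of a block elimination. *)
Lemma invform_congr q (U S : 'M[R]_q) a b :
  U \in unitmx -> S \in unitmx ->
  invform (U *m S *m U^T) (a *m U^T) (b *m U^T) = invform S a b.
Proof.
move=> Uu Su; have Utu : U^T \in unitmx by rewrite unitmx_tr.
rewrite /invform; have -> : a *m U^T *m invmx (U *m S *m U^T) =
    a *m invmx S *m invmx U.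
  apply: (canRL (mulmxK Uu)).
  have X : U *m S *m U^T \in unitmx by rewrite !unitmx_mul Uu Su.
  have -> : invmx (U *m S *m U^T) = invmx U^T *m invmx S *m invmx U.
    apply: (can_inj (mulmxK X)); rewrite mulVmx//.
    by rewrite !mulmxA mulmxKV// mulmxKV// mulVmx.
  by rewrite !mulmxA mulmxK// mulmxKV.
by rewrite trmx_mul trmxK !mulmxA mulmxKV.
Qed.

(** * Schur complement of the observed block *)

Section schur.
Variables (p n : nat) (A : 'M[R]_p) (B : 'M[R]_(p, n)) (C : 'M[R]_n).
Hypothesis T_pd : posdefmx (block_mx A B B^T C).

Lemma posdef_dr : posdefmx C.
Proof.
case: T_pd => Tt Tpos; split.
  by move: Tt; rewrite tr_block_mx => /eq_block_mx[].
move=> z z0; have /Tpos : row_mx (0 : 'rV_p) z != 0.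
  by apply: contra_neq z0 => /eqP; rewrite row_mx_eq0 => /andP[_ /eqP].
by rewrite mul_row_block !mul0mx !add0r tr_row_mx mul_row_col trmx0 mulmx0 add0r.
Qed.

Let Cu := posdef_unit posdef_dr.

Definition schur : 'M[R]_p := A - B *m invmx C *m B^T.

(** In Gaussian terms, [t] minus its conditional mean given that the observed block equals [s];
    [schur] is the conditional covariance. *)
Definition schur_row (t : 'rV[R]_p) (s : 'rV[R]_n) : 'rV[R]_p :=
  t - s *m invmx C *m B^T.

(** Block elimination: by [TE] the full matrix is U diag([schur], C) U^T, and by [row_mxE] the
    vector (t, s) has first block [schur_row t s] in the new basis. *)
Let U : 'M[R]_(p + n) := block_mx 1%:M (B *m invmx C) 0 1%:M.

Let Uu : U \in unitmx.
Proof. by rewrite unitmxE det_ublock !det1 mulr1 unitr1. Qed.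

Let Ct : (invmx C)^T = invmx C.
Proof. by rewrite trmx_inv; case: posdef_dr => ->. Qed.

Let Ut : U^T = block_mx 1%:M 0 (invmx C *m B^T) 1%:M.
Proof. by rewrite tr_block_mx !trmx1 trmx0 trmx_mul Ct. Qed.

Let TE : block_mx A B B^T C = U *m block_mx schur 0 0 C *m U^T.
Proof.
rewrite Ut /U mulmx_block !mul1mx !mul0mx !mulmx0 !addr0 !add0r mulmxKV//.
rewrite mulmx_block !mulmx1 !mulmx0 !add0r ?mul0mx !mulmxA.
by rewrite mulmxV// mul1mx /schur subrK.
Qed.

Let row_mxE t s : row_mx t s = row_mx (schur_row t s) s *m U^T.
Proof.
by rewrite Ut mul_row_block !mulmx1 mulmx0 add0r /schur_row mulmxA subrK.
Qed.

Lemma schur_posdef : posdefmx schur.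
Proof.
case: T_pd => Tt Tpos; split.
  move: Tt; rewrite tr_block_mx => /eq_block_mx[At _ _ _].
  by rewrite /schur linearB /= !trmx_mul trmxK Ct At mulmxA.
move=> z z0.
have U0 : invmx U *m U = 1%:M by rewrite mulVmx.
(* At the vector (z, 0) U^-1 the form of the full matrix takes the value z [schur] z^T. *)
have /Tpos : row_mx z (0 : 'rV_n) *m invmx U != 0.
  apply: contra_neq z0 => /(congr1 (mulmx^~ U)).
  by rewrite mulmxKV// mul0mx => /eqP; rewrite row_mx_eq0 => /andP[/eqP].
rewrite TE !mulmxA mulmxKV// trmx_mul !mulmxA -[_ *m U^T *m _]mulmxA.
rewrite -trmx_mul U0 trmx1 mulmx1 mul_row_block !mul0mx !mulmx0 !addr0.
by rewrite tr_row_mx mul_row_col mul0mx addr0.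
Qed.

Lemma invform_schur t s t' s' :
  invform (block_mx A B B^T C) (row_mx t s) (row_mx t' s') =
  invform schur (schur_row t s) (schur_row t' s') + invform C s s'.
Proof.
have Su := posdef_unit schur_posdef.
have Du : block_mx schur 0 0 C \in unitmx by rewrite block_diag_mx_unit Su Cu.
rewrite (row_mxE t) (row_mxE t') TE invform_congr// /invform.
rewrite invmx_block_diag// mul_row_block !mulmx0 addr0 add0r.
by rewrite tr_row_mx mul_row_col mxE.
Qed.

Lemma det_schur : \det (block_mx A B B^T C) = \det schur * \det C.
Proof.
rewrite TE !det_mulmx det_tr det_ublock !det1 det_ublock.
by rewrite !mulr1 mul1r.
Qed.

End schur.

(** Induction on the dimension, splitting off the first row and column: the determinant is a
    positive 1 x 1 Schur complement times that of a smaller positive definite block. *)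
Lemma posdef_det_gt0 n (S : 'M[R]_n) : posdefmx S -> 0 < \det S.
Proof.
elim: n S => [S _|n IH]; first by rewrite det_mx00 ltr01.
change (forall S : 'M[R]_(1 + n), posdefmx S -> 0 < \det S) => S.
rewrite -[S]submxK => Spd.
have E : dlsubmx S = (ursubmx S)^T.
  by case: Spd; rewrite tr_block_mx => /eq_block_mx[].
rewrite E in Spd *; rewrite det_schur// mulr_gt0//; last first.
  exact: IH (posdef_dr Spd).
have [_ /(_ 1%:M)] := schur_posdef Spd.
rewrite det_mx11 mul1mx trmx1 mulmx1; apply.
by apply/eqP => /matrixP/(_ 0 0); rewrite !mxE /= => /eqP; rewrite oner_eq0.
Qed.

(** * Rank-one updates *)

Section rank_one_update.
Variables (p : nat) (C : 'M[R]_p) (rho : 'rV[R]_p) (c : R).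
Hypotheses (C_pd : posdefmx C) (c_gt0 : 0 < c).
Let d := invform C rho rho.

Definition rank1_update : 'M[R]_p := C + c^-1 *: (rho^T *m rho).

Lemma rank1_update_posdef : posdefmx rank1_update.
Proof.
case: C_pd => Ct Cpos; split.
  by rewrite linearD linearZ /= trmx_mul trmxK Ct.
move=> z z0; rewrite mulmxDr mulmxDl mxE ltr_wpDr ?Cpos//.
rewrite -scalemxAr -scalemxAl mxE mulr_ge0 ?invr_ge0 ?(ltW c_gt0)//.
rewrite mulmxA -[_ *m rho *m _]mulmxA mxE big_ord1 [X in _ * X]mulmx_tr11.
by rewrite -expr2 sqr_ge0.
Qed.

(** Sherman-Morrison formula; [w] is the claimed value of x [rank1_update]^-1, verified by
    multiplying back. *)
Lemma invform_rank1_update x :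
  invform rank1_update x x =
  invform C x x - invform C x rho ^+ 2 / (c + d).
Proof.
have Cu := posdef_unit C_pd; have Mu := posdef_unit rank1_update_posdef.
have cd0 : c + d != 0 by rewrite gt_eqF// ltr_wpDr// invform_ge0.
pose b := invform C x rho.
pose w := x *m invmx C - (b / (c + d)) *: (rho *m invmx C).
have wM : w *m rank1_update = x.
  have E (y : 'rV[R]_p) : y *m invmx C *m (rho^T *m rho) =
      invform C y rho *: rho.
    by rewrite mulmxA [X in X *m rho]mx11_scalar mul_scalar_mx.
  rewrite mulmxDr !mulmxBl -!scalemxAl -!scalemxAr mulmxKV// mulmxKV//.
  rewrite !E -/b -/d; apply/rowP => i; rewrite !mxE.
  by field; rewrite cd0 gt_eqF.
have -> : invform rank1_update x x = (w *m x^T) 0 0.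
  by rewrite /invform -{1}wM mulmxK.
have BZ k (M N : 'M[R]_1) : (M - k *: N) 0 0 = M 0 0 - k * N 0 0.
  by rewrite !mxE.
rewrite mulmxBl -scalemxAl BZ -!/(invform _ _ _) (invformC rho); last first.
  by case: C_pd.
by rewrite -/b mulrAC -expr2.
Qed.

(** Matrix determinant lemma: the bordered matrix [X] is factored into block triangular matrices in
    two ways, pivoting on [c] in one and on [C] in the other. *)
Lemma det_rank1_update : c * \det rank1_update = \det C * (c + d).
Proof.
have Cu := posdef_unit C_pd.
pose X : 'M[R]_(p + 1) := block_mx C rho^T (- rho) c%:M.
have X1 : X = block_mx 1%:M (c^-1 *: rho^T) 0 1%:M *m
              block_mx rank1_update 0 (- rho) c%:M.
  rewrite mulmx_block !mul1mx !mul0mx ?mulmx0 ?add0r ?addr0.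
  rewrite mul_mx_scalar scalerA mulfV ?gt_eqF// scale1r.
  by rewrite mulmxN -scalemxAl /rank1_update addrK.
have X2 : X = block_mx C 0 (- rho) (c%:M + rho *m invmx C *m rho^T) *m
              block_mx 1%:M (invmx C *m rho^T) 0 1%:M.
  rewrite mulmx_block !mulmx1 !mul0mx ?mulmx0 ?add0r ?addr0 mulKVmx//.
  by rewrite mulNmx addrC mulmxA addrK.
have := congr1 determinant X1; rewrite X2 !det_mulmx !det_ublock !det_lblock.
have -> : \det (c%:M + rho *m invmx C *m rho^T) = c + d.
  by rewrite det_mx11 mxE mxE mulr1n.
by rewrite !det1 det_scalar1 !mulr1 !mul1r => E; rewrite E mulrC.
Qed.

End rank_one_update.

Local Notation one := (const_mx 1).

(* The minimum over u of [invform S (z - const_mx u) (z - const_mx u)]. *)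
Definition residual q (S : 'M[R]_q) (z : 'rV[R]_q) : R :=
  invform S z z - invform S z one ^+ 2 / invform S one one.

Lemma nonconst_dim q (z : 'rV[R]_q) : ~ (exists c, z = const_mx c) -> (0 < q)%N.
Proof.
case: q z => // z zN; exfalso; apply: zN; exists 0.
by apply/rowP => -[].
Qed.

Lemma one_neq0 q : (0 < q)%N -> one != 0 :> 'rV[R]_q.
Proof.
case: q => // q _; apply/eqP => /rowP/(_ 0); rewrite !mxE => /eqP.
by rewrite oner_eq0.
Qed.

Lemma invform_one_gt0 q (S : 'M[R]_q) :
  (0 < q)%N -> posdefmx S -> 0 < invform S one one.
Proof. by move=> q0 S_pd; rewrite invform_gt0// one_neq0. Qed.

(** The asymmetric form in which the residual enters the scale parameter of the statement. *)
Lemma residualE q (S : 'M[R]_q) (z : 'rV[R]_q) : (0 < q)%N -> posdefmx S ->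
  residual S z = invform S (z - (invform S z one / invform S one one) *: one) z.
Proof.
move=> q0 S_pd; rewrite /residual invformDl invformNl invformZl (invformC one z).
  by rewrite expr2 mulrAC.
by case: S_pd.
Qed.

(** Completing the square, the residual is the form at z - mu 1, a vector that vanishes only if z is
    constant. *)
Lemma residual_gt0 q (S : 'M[R]_q) (z : 'rV[R]_q) : posdefmx S ->
  ~ (exists c, z = const_mx c) -> 0 < residual S z.
Proof.
move=> S_pd zN; have q0 := nonconst_dim zN.
have c0 := invform_one_gt0 q0 S_pd; have [St _] := S_pd.
pose mu := invform S z one / invform S one one.
rewrite (_ : residual S z = invform S (z - mu *: one) (z - mu *: one)).
  apply: invform_gt0 => //; apply/negP; rewrite subr_eq0 => /eqP E.
  by apply: zN; exists mu; rewrite E scalemx_const mulr1.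
rewrite /residual !(invformDl, invformDr, invformNl, invformNr).
rewrite !(invformZl, invformZr) (invformC one z)// /mu.
by field; rewrite gt_eqF.
Qed.

(** * Universal kriging: eliminating the observed block with an unknown mean *)

Section kriging.
Variables (p n : nat) (A : 'M[R]_p) (B : 'M[R]_(p, n)) (C : 'M[R]_n).
Variable y : 'rV[R]_n.
Hypothesis T_pd : posdefmx (block_mx A B B^T C).
Hypothesis n_gt0 : (0 < n)%N.
Let T := block_mx A B B^T C.
Let c := invform C one one.
Let mu := invform C y one / c.
Let rho := schur_row B C one one.

(** As [schur_row B C 0 (- y)] is y C^-1 B^T, this is mu 1 + (y - mu 1) C^-1 B^T, the universal
    kriging predictor, where mu is the generalized least squares estimate of the mean. *)
Definition post_loc : 'rV[R]_p :=
  schur_row B C 0 (- y) + (invform C y one / invform C one one) *: rho.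

(** The conditional covariance, increased by a rank-one term that accounts for the uncertainty on
    the mean. *)
Definition post_scale : 'M[R]_p :=
  rank1_update (schur A B C) (schur_row B C one one) (invform C one one).

Let C_pd := posdef_dr T_pd.
Let S_pd := schur_posdef T_pd.
Let c_gt0 : 0 < c. Proof. exact: invform_one_gt0. Qed.

Lemma post_scale_posdef : posdefmx post_scale.
Proof. exact: rank1_update_posdef. Qed.

Let one_block : one = row_mx one one :> 'rV[R]_(p + n).
Proof. by rewrite row_mx_const. Qed.

(** With x = t - loc, the reduced first block of (t, y) is x + mu rho, and that of the constant
    vector is rho. All terms then become polynomials in the forms of x and rho, and the
    Sherman-Morrison formula is what remains after minimization over the mean. *)
Lemma residual_block t : residual T (row_mx t y) =
  residual C y + invform post_scale (t - post_loc) (t - post_loc).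
Proof.
have [St _] := S_pd; have [Ct _] := C_pd.
rewrite invform_rank1_update//.
have d_ge0 : 0 <= invform (schur A B C) rho rho by exact: invform_ge0.
have cd : 0 < c + invform (schur A B C) rho rho by rewrite ltr_wpDr.
(* The existentials make [x] and [m] opaque, so that the final [field] sees atoms. *)
have [x xE] : exists x, x = t - post_loc by eexists.
have [m mE] : exists m, m = mu by eexists.
have xmE : schur_row B C t y = x + m *: rho.
  rewrite xE /post_loc /schur_row -/rho -/c -/mu mE sub0r mulNmx mulNmx opprK.
  by rewrite opprD addrA addrNK.
rewrite /residual one_block !invform_schur// xmE -xE -!/rho -!/c.
move: (rho) d_ge0 cd => r d_ge0 cd.
rewrite !(invformDl, invformDr, invformZl, invformZr) (invformC r x)//.
have -> : invform C y one = m * c by rewrite mE mulfVK// gt_eqF.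
by field; rewrite !gt_eqF// addrC.
Qed.

(** Makes the normalizing constants of the joint and marginal limits comparable: the form of the
    constant vector of T is c + rho [schur]^-1 rho^T, the factor produced by the rank-one
    determinant. *)
Lemma det_block : \det T * invform T one one =
  \det post_scale * (\det C * invform C one one).
Proof.
rewrite det_schur// one_block invform_schur// [X in _ * X]addrC mulrAC.
by rewrite -det_rank1_update// -/rho -/c -/post_scale [c * _]mulrC -!mulrA
  [c * _]mulrC.
Qed.

End kriging.

End linear_algebra.

(** * Integrals over v and u *)

Section calculus.
Variable R : realType.
Local Notation leb := (@lebesgue_measure R).

(** Squeeze: F m e lies above the diagonal term of index [N (m, e)], which tends to infinity, and
    below some later diagonal term, hence below l, the supremum of the diagonal. *)
Lemma cvge_pinfty_right0_monotone (F : R -> R -> \bar R) (l : \bar R) :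
  (forall m m' e e', m <= m' -> 0 < e' -> e' <= e -> (F m e <= F m' e')%E) ->
  (fun n => F n.+1%:R n.+1%:R^-1) @ \oo --> l ->
  F me.1 me.2 @[me --> (+oo, 0^'+)] --> l.
Proof.
move=> Fmono Fl.
pose u n := F n.+1%:R n.+1%:R^-1.
have u_nd : {homo u : n m / (n <= m)%N >-> (n <= m)%E}.
  by move=> n n' nn'; apply: Fmono; rewrite ?invr_gt0 ?lef_pV2 ?posrE ?ltr0n ?ler_nat.
have lE : l = ereal_sup (range u).
  by rewrite -(cvg_lim _ (ereal_nondecreasing_cvgn u_nd))//; exact/esym/cvg_lim.
(* The largest n with n + 1 <= m and n + 1 <= 1/e; the predecessor compensates for the shift in
   [u]. *)
pose N (me : R * R) := (Num.truncn (Num.min me.1 me.2^-1)).-1.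
have near_ge (k : nat) : \forall me \near (+oo, (0:R)^'+),
    [/\ (k.+1%:R : R) <= me.1, 0 < me.2 & me.2 <= k.+1%:R^-1 :> R].
  apply: filter_pair_near_of => x y xn yn /=; split.
  - by near: x; exact: nbhs_pinfty_ge.
  - by near: y; exact: nbhs_right_gt.
  - by near: y; apply: nbhs_right_ltW; rewrite invr_gt0 ltr0n.
have near_N k : \forall me \near (+oo, (0:R)^'+), (k <= N me)%N.
  have := near_ge k; apply: filterS => -[m e] /= [km e0 ek].
  rewrite /N /= -ltnS prednK ?truncn_gt0 ?truncn_gt_nat le_min.
    by rewrite km -[leLHS]invrK lef_pV2 ?posrE ?invr_gt0 ?ltr0n.
  rewrite -[X in _ && (X <= _)]invr1 lef_pV2 ?posrE// (le_trans _ km) ?ler1n//.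
  by rewrite (le_trans ek)// invf_le1 ?ler1n ?ltr0n.
apply: (@squeeze_cvge _ _ _ _ (u \o N) _ (cst l)).
- have := near_ge 0%N; apply: filterS => -[m e] /= [m1 e0 e1].
  have mn0 : 1 <= Num.min m e^-1.
    by rewrite le_min m1 -[leLHS]invr1 lef_pV2 ?posrE//; rewrite invr1 in e1.
  apply/andP; split.
    have NE : (N (m, e)).+1 = Num.truncn (Num.min m e^-1).
      by rewrite /N prednK// truncn_gt0.
    have : (Num.truncn (Num.min m e^-1))%:R <= Num.min m e^-1.
      by rewrite -truncn_ge_nat// (le_trans _ mn0).
    rewrite le_min => /andP[? ?].
    rewrite /u NE; apply: Fmono => //.
    by rewrite -[leLHS]invrK lef_pV2 ?posrE ?invr_gt0// -NE ltr0n.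
  have [k /andP[mk ek]] : exists k : nat, (m <= k%:R) && (e^-1 <= k%:R).
    exists (Num.truncn (Num.max m e^-1)).+1.
    by rewrite -ge_max ltW// truncnS_gt.
  rewrite lE; apply: le_ereal_sup_tmp; exists (u k); first by exists k.
  apply: Fmono; rewrite ?invr_gt0 ?ltr0n//.
    by rewrite (le_trans mk)// ler_nat.
  rewrite -[leRHS]invrK lef_pV2 ?posrE ?invr_gt0 ?ltr0n//.
  by rewrite (le_trans ek)// ler_nat.
- by apply: cvg_comp Fl; exact/cvgnyPge.
- exact: cvg_cst.
Unshelve. all: by end_near. Qed.

(** Inversion is x times the power -1 of x^2, which is measurable; the identity persists at 0, whose
    inverse is 0. *)
Lemma measurable_invr : measurable_fun [set: R] (@GRing.inv R).
Proof.
rewrite (_ : GRing.inv = fun x : R => x * (x ^+ 2) `^ (-1)).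
  by apply: measurable_funM => //; apply: (@measurableT_comp _ _ _ _ _ _ (@powR R ^~ (-1))).
apply/funext => x; rewrite powR_inv1 ?sqr_ge0//.
have [->|x0] := eqVneq x 0; first by rewrite invr0 mul0r.
by rewrite expr2 invfM mulrA mulfV// mul1r.
Qed.

Lemma integral_normal_fun (m s : R) : s != 0 ->
  (\int[leb]_u (normal_fun m s u)%:E = (Num.sqrt (s ^+ 2 * pi *+ 2))%:E)%E.
Proof.
move=> s0; have p0 := normal_peak_gt0 s0.
have := integral_normal_pdf m s.
rewrite normal_pdfE//.
under eq_integral do rewrite EFinM.
rewrite ge0_integralZl//=; last 3 first.
- by apply/measurable_EFinP; exact: measurable_normal_fun.
- by move=> x _; rewrite lee_fin normal_fun_ge0.
- by rewrite lee_fin ltW.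
move=> E; rewrite -[RHS]mule1 -E muleA -EFinM mulfV ?mul1e//.
by rewrite -invr_eq0 gt_eqF.
Qed.

End calculus.

(** * The Gamma function and the integral over v *)

Section gamma.
Variable R : realType.
Local Notation leb := (@lebesgue_measure R).

Lemma measurable_exprnV n : measurable_fun [set: R] (fun v : R => v ^- n).
Proof.
rewrite (_ : (fun v => v ^- n) = (fun v : R => v^-1 ^+ n)).
  exact: measurable_funX (@measurable_invr R).
by apply/funext => v; rewrite exprVn.
Qed.

Lemma measurable_exprV_expRV k (r : R) :
  measurable_fun [set: R] (fun v => v ^- k.+1 * expR (- (r / (2 * v ^+ 2)))).
Proof.
apply: measurable_funM; first exact: measurable_exprnV.
apply: measurableT_comp => //; apply: measurableT_comp => //.
apply: measurable_funM => //; apply: (measurableT_comp (@measurable_invr R)).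
by apply: measurable_funM => //; exact: measurable_funX.
Qed.

Let gint (k : nat) (x : R) := x `^ (k%:R / 2 - 1) * expR (- x).
Let vint (k : nat) (r v : R) := v ^- k.+1 * expR (- (r / (2 * v ^+ 2))).

Let F (r v : R) := r / 2 * v^-1 ^+ 2.

Let F_gt0 r (v : R) : 0 < r -> 0 < v -> 0 < F r v.
Proof.
move=> r0 v0; apply: mulr_gt0; first exact: divr_gt0.
by rewrite exprn_gt0// invr_gt0.
Qed.

Let is_derive_F r (v : R) : 0 < v -> is_derive v 1 (F r) (- r * v^-1 ^+ 3).
Proof.
move=> v0; have vn0 : v != 0 by rewrite gt_eqF.
have dV : is_derive v 1 (@GRing.inv R) (- v ^- 2 *: 1).
  by apply: (@is_deriveV _ id) => //; exact: is_derive_id.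
have -> : F r = (r / 2) \*: ((@GRing.inv R) ^+ 2) :> (R -> R) by exact/funext.
apply: (is_derive_eq (is_deriveZ (r / 2) (is_deriveX 2 dV))).
by rewrite /GRing.scale /=; field; rewrite vn0.
Qed.

Let F'E r (v : R) : 0 < v -> (F r)^`()%classic v = - r * v^-1 ^+ 3.
Proof. by move=> v0; rewrite derive1E; have [] := is_derive_F r v0. Qed.

Let cvg_inv (v : R) : 0 < v -> x^-1 @[x --> v] --> v^-1.
Proof. by move=> v0; apply: cvgV => //; rewrite gt_eqF. Qed.

Let cvg_F' r (v : R) : 0 < v -> (F r)^`()%classic x @[x --> v] --> (F r)^`()%classic v.
Proof.
move=> v0; rewrite F'E//.
suff : (- r * x^-1 ^+ 3) @[x --> v] --> - r * v^-1 ^+ 3.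
  apply: cvg_trans; apply: near_eq_cvg; near=> x; rewrite F'E//.
  by near: x; exact: lt_nbhsr.
apply: cvgMr; apply: (cvg_comp (@GRing.inv R) (fun x => x ^+ 3)).
  exact: cvg_inv.
exact: exprn_continuous.
Unshelve. all: by end_near. Qed.

Let cvg_F r (v : R) : 0 < v -> F r x @[x --> v] --> F r v.
Proof.
move=> v0; apply: differentiable_continuous; apply/derivable1_diffP.
by have [] := is_derive_F r v0.
Qed.

Let cvg_gint k (x : R) : 0 < x -> {for x, continuous (gint k)}.
Proof.
move=> x0; apply: cvgM.
  have /derivable1_diffP/differentiable_continuous :
      derivable (@powR R ^~ (k%:R / 2 - 1)) x 1.
    by apply: derivable_powR; rewrite in_itv/= x0.
  exact.
apply: (@cvg_comp _ _ _ -%R (@expR R) _ (nbhs (- x))).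
  by apply: cvgN; exact: cvg_id.
exact: continuous_expR.
Qed.

Let F_homo r : 0 < r -> forall x y, 0 < x -> x < y -> F r y < F r x.
Proof.
move=> r0 x y x0 xy; rewrite /F ltr_pM2l ?divr_gt0//.
by rewrite ltrXn2r// ?invr_ge0 ?(ltW x0)// ?(ltW (lt_trans x0 xy))//
  ltf_pV2// posrE// (lt_trans x0).
Qed.

(** F^(k/2 - 1) is of order v^(2 - k) and the Jacobian is r v^-3, whence the power v^-(k+1). *)
Let vintE k r v : 0 < r -> 0 < v ->
  gint k (F r v) * - (F r)^`()%classic v = 2 * (r / 2) `^ (k%:R / 2) * vint k r v.
Proof.
move=> r0 v0; have rn0 : r != 0 by rewrite gt_eqF.
have vn0 : v != 0 by rewrite gt_eqF.
have r20 : 0 < r / 2 by rewrite divr_gt0.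
rewrite F'E// /gint /vint.
have -> : expR (- F r v) = expR (- (r / (2 * v ^+ 2))).
  by congr (expR (- _)); rewrite /F; field; rewrite vn0.
have F0 : F r v != 0 by rewrite mulf_neq0 ?gt_eqF// exprn_gt0// invr_gt0.
have -> : F r v `^ (k%:R / 2 - 1) = (r / 2) `^ (k%:R / 2) * v ^- k / F r v.
  rewrite powRB ?F0 ?implybT// powRr1; last first.
    by rewrite /F mulr_ge0 ?exprn_ge0 ?invr_ge0 ?ltW.
  congr (_ / _); rewrite /F powRM ?exprn_ge0 ?invr_ge0 ?ltW//; congr (_ * _).
  rewrite -powR_mulrn ?invr_ge0 ?ltW// -powRrM mulrCA mulfV// mulr1.
  by rewrite powR_mulrn ?invr_ge0 ?ltW// exprVn.
have -> : v ^- k.+1 = v^-1 * v ^- k by rewrite exprS invfM.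
rewrite /F; set E := expR _; set P := (_ `^ _); set Z := v ^- k.
by field; rewrite vn0 rn0.
Qed.

Let sub_itv k r (a b : R) : 0 < r -> 0 < a -> a <= b ->
  (\int[leb]_(x in `[F r b, F r a]) (gint k x)%:E =
   \int[leb]_(v in `[a, b]) (2 * (r / 2) `^ (k%:R / 2) * vint k r v)%:E)%E.
Proof.
move=> r0 a0 ab; have b0 := lt_le_trans a0 ab.
rewrite integration_by_substitution_decreasing//.
- apply: eq_integral => v; rewrite inE/= in_itv/= => /andP[av _].
  by rewrite -vintE// (lt_le_trans a0).
- move=> x y; rewrite !in_itv/= => /andP[ax _] /andP[ay _].
  by move=> xy; apply: F_homo => //; exact: lt_le_trans ay.
- move=> x; rewrite in_itv/= => /andP[ax _]; apply: cvg_F'; exact: lt_trans ax.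
- by apply/cvg_ex; eexists; apply: cvg_at_right_filter; exact: cvg_F'.
- by apply/cvg_ex; eexists; apply: cvg_at_left_filter; exact: cvg_F'.
- split.
  + move=> x; rewrite in_itv/= => /andP[ax _].
    by have [] := is_derive_F r (lt_trans a0 ax).
  + by apply: cvg_at_right_filter; exact: cvg_F.
  + by apply: cvg_at_left_filter; exact: cvg_F.
- apply: continuous_in_subspaceT => x; rewrite inE/= in_itv/= => /andP[Fx _].
  apply: cvg_gint; apply: lt_le_trans Fx.
  exact: F_gt0.
Qed.

Lemma nondecreasing_itv_inv :
  nondecreasing_seq (fun n => `[n.+1%:R^-1, n.+1%:R : R]%classic).
Proof.
move=> n m nm; rewrite subsetEset => x /=; rewrite !in_itv/= => /andP[nx xn].
rewrite (le_trans _ nx)/= ?(le_trans xn) ?ler_nat//.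
by rewrite lef_pV2 ?posrE ?ltr0n// ler_nat.
Qed.

Lemma bigcup_itv_inv :
  \bigcup_n `[n.+1%:R^-1, n.+1%:R : R]%classic = `]0, +oo[%classic.
Proof.
apply/seteqP; split => [x [n _]|x]; rewrite /= !in_itv/= ?andbT.
  by move=> /andP[nx _]; rewrite (lt_le_trans _ nx)// invr_gt0 ltr0n.
move=> x0; exists (Num.truncn (Num.max x x^-1)) => //=; rewrite in_itv/=.
have : Num.max x x^-1 <= (Num.truncn (Num.max x x^-1)).+1%:R.
  by rewrite ltW// truncnS_gt.
rewrite ge_max => /andP[-> h]; rewrite andbT -[leRHS]invrK.
by rewrite lef_pV2 ?posrE ?invr_gt0 ?ltr0n.
Qed.

Let mgint k : measurable_fun [set: R] (gint k).
Proof.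
apply: measurable_funM; first exact: measurable_powR.
exact: measurableT_comp.
Qed.

Let mvint k r : measurable_fun [set: R] (vint k r) := measurable_exprV_expRV k r.

(** The change of variables is made on the compact intervals [1/(n+1), n+1], whose images under the
    decreasing [F r] exhaust the half-line as well. The equality holds in the extended reals, so it
    can serve to prove finiteness. *)
Lemma Gamma_substitution k r : 0 < r ->
  (\int[leb]_(x in `]0%R, +oo[) (gint k x)%:E =
   (2 * (r / 2) `^ (k%:R / 2))%:E * \int[leb]_(v in `]0%R, +oo[) (vint k r v)%:E)%E.
Proof.
move=> r0.
rewrite -ge0_integralZl//=; last 3 first.
- by apply/measurable_EFinP/measurable_funTS; exact: mvint.
- move=> v; rewrite in_itv/= andbT => v0.
  by rewrite lee_fin mulr_ge0 ?expR_ge0// invr_ge0 exprn_ge0// ltW.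
- by rewrite lee_fin mulr_ge0// powR_ge0.
under [RHS]eq_integral do rewrite -EFinM.
pose a n : R := n.+1%:R^-1; pose b n : R := n.+1%:R.
have a0 n : 0 < a n by rewrite invr_gt0 ltr0n.
have ab n : a n <= b n.
  by rewrite (@le_trans _ _ 1)// ?ler1n// invf_le1 ?ler1n ?ltr0n.
have L : (\int[leb]_(x in `[F r (b n), F r (a n)]) (gint k x)%:E)%E @[n --> \oo]
    --> (\int[leb]_(x in `]0%R, +oo[) (gint k x)%:E)%E.
  rewrite (_ : `]0, +oo[%classic = \bigcup_n `[F r (b n), F r (a n)]%classic).
    apply: (@ge0_nondecreasing_set_cvg_integral _ (measurableTypeR R) R
      (fun n => `[F r (b n), F r (a n)]%classic) _ leb) => //.
    - move=> n m nm; rewrite subsetEset => x /=; rewrite !in_itv/=.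
      have Fle (s t : R) : 0 < s -> s <= t -> F r t <= F r s.
        move=> s0; rewrite le_eqVlt => /predU1P[->//|st].
        exact/ltW/F_homo.
      move=> /andP[bx xa]; rewrite (le_trans _ bx)/= ?(le_trans xa)//.
        by apply: Fle => //; rewrite lef_pV2 ?posrE ?ltr0n// ler_nat.
      by apply: Fle; rewrite ?ltr0n// ler_nat.
    - by move=> n; apply/measurable_EFinP/measurable_funTS; exact: mgint.
    - by move=> n x _; rewrite lee_fin mulr_ge0 ?powR_ge0 ?expR_ge0.
  apply/seteqP; split => [x /=|x [n _]]; rewrite /= !in_itv/= ?andbT; last first.
    by move=> /andP[bx _]; apply: lt_le_trans bx; rewrite F_gt0// ltr0n.
  (* The preimage of x under [F r]. *)
  move=> x0; pose v := Num.sqrt (r / (2 * x)).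
  have v0 : 0 < v by rewrite sqrtr_gt0 divr_gt0// mulr_gt0.
  have vE : F r v = x.
    rewrite /F exprVn sqr_sqrtr; last by rewrite divr_ge0 ?mulr_ge0 ?ltW.
    by field; rewrite !gt_eqF.
  have : `]0, +oo[%classic v by rewrite /= in_itv/= v0.
  rewrite -bigcup_itv_inv => -[n _ /=]; rewrite in_itv/= => /andP[nv vn]; exists n => //=.
  have Fle (s t : R) : 0 < s -> s <= t -> F r t <= F r s.
    move=> s0; rewrite le_eqVlt => /predU1P[->//|st].
    exact/ltW/F_homo.
  by rewrite in_itv/= -vE !Fle.
rewrite -(cvg_lim _ L)//; apply: cvg_lim => //.
rewrite (funext (fun n => sub_itv k r0 (a0 n) (ab n))) -bigcup_itv_inv.
apply: (@ge0_nondecreasing_set_cvg_integral _ (measurableTypeR R) R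
      (fun n => `[a n, b n]%classic) _ leb) => //.
- exact: nondecreasing_itv_inv.
- move=> n; apply/measurable_EFinP/measurable_funTS.
  by apply: measurable_funM => //; exact: mvint.
- move=> n v /=; rewrite in_itv/= => /andP[av _].
  rewrite lee_fin mulr_ge0 ?mulr_ge0 ?powR_ge0 ?expR_ge0//.
  by rewrite invr_ge0 exprn_ge0// (le_trans _ av) ?ltW.
Qed.

Let vint_ge0 k r v : 0 < v -> 0 <= vint k r v.
Proof. by move=> v0; rewrite mulr_ge0 ?expR_ge0// invr_ge0 exprn_ge0// ltW. Qed.

Lemma integral_exprN2 : (\int[leb]_(v in `[1%R, +oo[) (v ^- 2)%:E = 1)%E.
Proof.
have dF (v : R) : 0 < v -> is_derive v 1 (fun v : R => - v^-1) (v ^- 2).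
  move=> v0; have dV : is_derive v 1 (@GRing.inv R) (- v ^- 2 *: 1).
    by apply: (@is_deriveV _ id); rewrite ?gt_eqF//; exact: is_derive_id.
  by apply: is_derive_eq (is_deriveN dV) _; rewrite scaleNr opprK /GRing.scale/= mulr1.
rewrite (@ge0_continuous_FTC2y _ _ (fun v : R => - v^-1) _ 0).
- by rewrite invr1 -EFinB sub0r opprK.
- by move=> x x1; rewrite invr_ge0 sqr_ge0.
- apply: continuous_in_subspaceT => x; rewrite inE/= in_itv/= andbT => x1.
  have x0 : 0 < x by rewrite (lt_le_trans _ x1).
  apply: (@cvgV _ _ _ _ (fun x : R => x ^+ 2)); first by rewrite gt_eqF// exprn_gt0.
  exact: exprn_continuous.
- rewrite -[X in _ --> X]oppr0; apply: cvgN.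
  apply/(@gtr0_cvgV0 _ _ _ _ (fun x : R => x)); last exact: cvg_id.
  exact: nbhs_pinfty_gt.
- by move=> x x1; have [] := dF x (lt_trans ltr01 x1).
- apply: cvg_at_right_filter; have [d1 _] := dF 1 ltr01.
  by move/derivable1_diffP/differentiable_continuous : d1; exact.
- move=> x; rewrite in_itv/= andbT => x1.
  by rewrite derive1E; have [] := dF x (lt_trans ltr01 x1).
Qed.

(** On ]0, 1[ the exponential makes the integrand bounded; on [1, +oo[ it is at most v^-2, because k
    > 0. *)
Lemma integral_vint_lty k r : (0 < k)%N -> 0 < r ->
  (\int[leb]_(v in `]0%R, +oo[) (vint k r v)%:E < +oo)%E.
Proof.
move=> k0 r0.
have -> : `]0, +oo[%classic = `]0, 1[%classic `|` `[1, +oo[%classic :> set R.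
  by rewrite -itv_bndbnd_setU// bnd_simp.
rewrite ge0_integral_setU//=; last 3 first.
- by apply/measurable_EFinP/measurable_funTS; exact: mvint.
- move=> v; rewrite !in_itv/= => -[/andP[v0 _]|/andP[v1 _]].
    by rewrite lee_fin vint_ge0.
  by rewrite lee_fin vint_ge0// (lt_le_trans _ v1).
- apply/disj_setPS => v [/=]; rewrite !in_itv/= => /andP[_ v1] /andP[].
  by rewrite leNgt v1.
apply: lte_add_pinfty.
  (* From exp (- x) <= (k+1)! / x^(k+1) at x = r / (2 v^2), the integrand is at most (k+1)! (2 v /
     r)^(k+1), and v < 1. *)
  pose c := (k.+1)`!%:R * (2 / r) ^+ k.+1.
  apply: (@le_lt_trans _ _ (\int[leb]_(v in `]0%R, 1%R[) c%:E)%E).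
    apply: ge0_le_integral => //=.
    + by move=> v; rewrite in_itv/= => /andP[v0 _]; rewrite lee_fin vint_ge0.
    + by apply/measurable_EFinP/measurable_funTS; exact: mvint.
    + move=> v; rewrite in_itv/= => /andP[v0 v1]; rewrite lee_fin /vint.
      have x0 : 0 < r / (2 * v ^+ 2) by rewrite divr_gt0// mulr_gt0// exprn_gt0.
      set x := r / _ in x0 *; have vx0 : 0 < v * x by exact: mulr_gt0.
      have f0 : 0 < k.+1`!%:R :> R by rewrite ltr0n fact_gt0.
      have ex : x ^+ k.+1 / k.+1`!%:R <= expR x.
        by apply: le_trans (expR_ge1Dxn k (ltW x0)); rewrite lerDr.
      have : expR (- x) <= k.+1`!%:R / x ^+ k.+1.
        rewrite expRN -[leRHS]invrK lef_pV2 ?posrE ?expR_gt0//.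
          by rewrite invf_div.
        by rewrite invr_gt0 divr_gt0// exprn_gt0.
      move=> /(ler_wpM2l (_ : 0 <= v ^- k.+1)) -/(_ _)/le_trans; apply.
        by rewrite invr_ge0 exprn_ge0// ltW.
      rewrite mulrCA -invfM -exprMn /c ler_pM2l// -exprVn lerXn2r// ?nnegrE.
      - by rewrite invr_ge0 ltW.
      - by rewrite divr_ge0// ltW.
      - have -> : (v * x)^-1 = 2 / r * v by rewrite /x; field; rewrite !gt_eqF.
        by rewrite ler_piMr ?divr_ge0 ?ltW.
  rewrite integral_cst//= lebesgue_measure_itv/= lte01 oppr0 adde0 mule1.
  by rewrite ltry.
apply: (@le_lt_trans _ _ (\int[leb]_(v in `[1%R, +oo[) (v ^- 2)%:E)%E).
  apply: ge0_le_integral => //=.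
  + move=> v; rewrite in_itv/= andbT => v1.
    by rewrite lee_fin vint_ge0// (lt_le_trans _ v1).
  + by apply/measurable_EFinP/measurable_funTS; exact: mvint.
  + by apply/measurable_EFinP/measurable_funTS; exact: measurable_exprnV.
  + move=> v; rewrite in_itv/= andbT => v1; have v0 := lt_le_trans ltr01 v1.
    rewrite lee_fin /vint -[leRHS]mulr1 ler_pM ?expR_ge0//.
    * by rewrite invr_ge0 exprn_ge0// ltW.
    * by rewrite lef_pV2 ?posrE ?exprn_gt0// ler_weXn2l.
    * by rewrite expR_le1 oppr_le0 divr_ge0 ?mulr_ge0 ?exprn_ge0// ltW.
by rewrite integral_exprN2 ltry.
Qed.

Lemma integral_vint_gt0 k r : 0 < r ->
  (0 < \int[leb]_(v in `]0%R, +oo[) (vint k r v)%:E)%E.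
Proof.
move=> r0; pose c := 2 ^- k.+1 * expR (- (r / 2)).
apply: (@lt_le_trans _ _ (\int[leb]_(v in `[1%R, 2%R]) c%:E)%E).
  rewrite integral_cst//= lebesgue_measure_itv/= lte_fin ltr1n.
  by rewrite -EFinB -EFinM lte_fin mulr_gt0// ?mulr_gt0 ?expR_gt0 ?invr_gt0 ?exprn_gt0//.
apply: (@le_trans _ _ (\int[leb]_(v in `[1%R, 2%R]) (vint k r v)%:E)%E).
  apply: ge0_le_integral => //=.
  + by move=> v _; rewrite lee_fin mulr_ge0 ?expR_ge0// invr_ge0 exprn_ge0.
  + by apply/measurable_EFinP/measurable_funTS; exact: mvint.
  + move=> v; rewrite in_itv/= => /andP[v1 v2]; have v0 := lt_le_trans ltr01 v1.
    rewrite lee_fin /vint ler_pM ?expR_ge0 ?invr_ge0 ?exprn_ge0//.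
      by rewrite lef_pV2 ?posrE ?exprn_gt0// lerXn2r ?nnegrE ?(ltW v0).
    rewrite ler_expR lerN2 ler_pM2l// lef_pV2 ?posrE ?mulr_gt0 ?exprn_gt0//.
    by rewrite ler_peMr// exprn_ege1.
apply: ge0_subset_integral => //=.
- by apply/measurable_EFinP/measurable_funTS; exact: mvint.
- by move=> v; rewrite in_itv/= andbT => v0; rewrite lee_fin vint_ge0.
- by move=> v /=; rewrite !in_itv/= andbT => /andP[v1 _]; rewrite (lt_le_trans _ v1).
Qed.

(** [Gamma] is a real-valued integral, which would be 0 if the integral were infinite; finiteness
    comes from the substitution at r = 2, where (r / 2)^(k/2) is 1. *)
Lemma integral_Gamma k : (0 < k)%N ->
  (\int[leb]_(x in `]0%R, +oo[) (x `^ (k%:R / 2 - 1) * expR (- x))%:E =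
   (Gamma (k%:R / 2 : R))%:E)%E.
Proof.
move=> k0; rewrite /Gamma /Rintegral fineK// ge0_fin_numE; last first.
  by apply: integral_ge0 => x _; rewrite lee_fin mulr_ge0 ?powR_ge0 ?expR_ge0.
by rewrite (@Gamma_substitution k 2)// lte_mul_pinfty// ?lee_fin ?mulr_ge0 ?powR_ge0//
  ?fin_numE//; exact: integral_vint_lty.
Qed.

Lemma integral_inverse_gamma k r : (0 < k)%N -> 0 < r ->
  (\int[leb]_(v in `]0%R, +oo[) (v ^- k.+1 * expR (- (r / (2 * v ^+ 2))))%:E =
   (Gamma (k%:R / 2) / (2 * (r / 2) `^ (k%:R / 2)))%:E)%E.
Proof.
move=> k0 r0; have := Gamma_substitution k r0; rewrite integral_Gamma//.
have c0 : 0 < 2 * (r / 2) `^ (k%:R / 2) by rewrite mulr_gt0// powR_gt0// divr_gt0.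
move=> E; rewrite mulrC EFinM E muleA -EFinM mulVf ?mul1e// gt_eqF//.
Qed.

Lemma Gamma_half_gt0 k : (0 < k)%N -> 0 < Gamma (k%:R / 2 : R).
Proof.
move=> k0; rewrite -lte_fin -integral_Gamma// (@Gamma_substitution k 2)//.
by rewrite mule_gt0 ?integral_vint_gt0// lte_fin mulr_gt0// powR_gt0// divr_gt0.
Qed.

End gamma.

(** * Tonelli's theorem over a rectangle *)

Section tonelli_on_sets.
Local Open Scope ereal_scope.
Context d1 d2 (T1 : measurableType d1) (T2 : measurableType d2) (R : realType).
Variables (m1 : {sigma_finite_measure set T1 -> \bar R})
          (m2 : {sigma_finite_measure set T2 -> \bar R}).
Variables (f : T1 -> T2 -> \bar R) (A : set T1) (B : set T2).
Hypotheses (mA : measurable A) (mB : measurable B).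
Hypothesis mf : measurable_fun setT (fun xy => f xy.1 xy.2).
Hypothesis f0 : forall x y, 0 <= f x y.

Let g xy := ((fun xy => f xy.1 xy.2) \_ (A `*` B)) xy.

Let mg : measurable_fun setT g.
Proof.
by apply/(measurable_restrictT _ (measurableX mA mB))/measurable_funTS.
Qed.

Let g0 xy : 0 <= g xy.
Proof. by rewrite /g patchE; case: ifP. Qed.

Lemma measurable_fun_integral_section :
  measurable_fun setT (fun x => \int[m2]_(y in B) f x y).
Proof.
pose h xy := ((fun xy => f xy.1 xy.2) \_ (setT `*` B)) xy.
have mh : measurable_fun setT h.
  by apply/(measurable_restrictT _ (measurableX measurableT mB))/measurable_funTS.
have h0 xy : 0 <= h xy by rewrite /h patchE; case: ifP.
have := measurable_fun_fubini_tonelli_F (m2 := m2) h mh h0.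
apply: eq_measurable_fun => x _; rewrite [RHS]integral_mkcond.
by apply: eq_integral => y _; rewrite /h !patchE in_setX in_setT.
Qed.

Lemma tonelli_sets :
  \int[m1]_(x in A) \int[m2]_(y in B) f x y =
  \int[m2]_(y in B) \int[m1]_(x in A) f x y.
Proof.
have := fubini_tonelli (m1 := m1) (m2 := m2) g mg g0 => E.
rewrite [LHS]integral_mkcond [RHS]integral_mkcond.
transitivity (\int[m1]_x \int[m2]_y g (x, y)).
  apply: eq_integral => x _; rewrite patchE; case: ifPn => xA.
    rewrite integral_mkcond; apply: eq_integral => y _.
    by rewrite /g !patchE in_setX xA.
  rewrite integral0_eq// => y _; rewrite /g patchE in_setX.
  by rewrite (negbTE xA).
rewrite E; apply: eq_integral => y _; rewrite patchE; case: ifPn => yB.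
  rewrite [RHS]integral_mkcond; apply: eq_integral => x _.
  by rewrite /g !patchE in_setX yB andbT.
rewrite integral0_eq// => x _; rewrite /g patchE in_setX.
by rewrite (negbTE yB) andbF.
Qed.

End tonelli_on_sets.

(** * The Gaussian kernel and its integral over the half-plane *)

Section kernel.
Variable R : realType.
Local Notation leb := (@lebesgue_measure R).
Local Notation one := (const_mx 1).

(* With Q = z S^-1 z^T, B = z S^-1 1^T and c = 1 S^-1 1^T, this is the normal
   density with mean (u, ..., u) and covariance v^2 S, of normalization K, at z.
   Only v > 0 matters; the absolute value makes the kernel nonnegative for all v. *)
Definition kern (N : nat) (K Q B c v u : R) : R :=
  K * `|v| ^- N * expR (- ((Q - 2 * u * B + u ^+ 2 * c) / (2 * v ^+ 2))).

Lemma kern_ge0 N K Q B c v u : 0 <= K -> 0 <= kern N K Q B c v u.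
Proof. by move=> K0; rewrite !mulr_ge0 ?expR_ge0// invr_ge0 exprn_ge0. Qed.

Lemma measurable_kern d (T : measurableType d) N K (c : R) (Q B v u : T -> R) :
  measurable_fun setT Q -> measurable_fun setT B ->
  measurable_fun setT v -> measurable_fun setT u ->
  measurable_fun setT (fun x => kern N K (Q x) (B x) c (v x) (u x)).
Proof.
move=> mQ mB mv mu; apply: measurable_funM.
  apply: measurable_funM => //.
  apply: (@measurableT_comp _ _ _ _ _ _ (fun v : R => v ^- N)).
    exact: measurable_exprnV.
  exact: measurableT_comp.
apply: measurableT_comp => //; apply: measurableT_comp => //.
apply: measurable_funM.
  apply: measurable_funD.
    apply: measurable_funB => //; apply: measurable_funM => //.
    exact: measurable_funM.
  by apply: measurable_funM => //; exact: measurable_funX.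
apply: (measurableT_comp (@measurable_invr R)).
by apply: measurable_funM => //; exact: measurable_funX.
Qed.

Definition kern_const q (S : 'M[R]_q) : R := (Num.sqrt ((2 * pi) ^+ q * \det S))^-1.

Definition kernS q (S : 'M[R]_q) (z : 'rV[R]_q) :=
  kern q (kern_const S) (invform S z z) (invform S z one) (invform S one one).

Lemma kern_const_gt0 q (S : 'M[R]_q) : posdefmx S -> 0 < kern_const S.
Proof.
move=> S_pd; rewrite invr_gt0 sqrtr_gt0 mulr_gt0 ?posdef_det_gt0//.
by rewrite exprn_gt0// mulr_gt0// pi_gt0.
Qed.

Lemma kernS_ge0 q (S : 'M[R]_q) z v u : posdefmx S -> 0 <= kernS S z v u.
Proof. by move=> S_pd; apply/kern_ge0/ltW/kern_const_gt0. Qed.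

Lemma invform_shift q (S : 'M[R]_q) z u : posdefmx S ->
  invform S (z - const_mx u) (z - const_mx u) =
  invform S z z - 2 * u * invform S z one + u ^+ 2 * invform S one one.
Proof.
move=> [St _]; have -> : const_mx u = u *: one :> 'rV[R]_q.
  by rewrite scalemx_const mulr1.
rewrite !(invformDl, invformDr, invformNl, invformNr, invformZl, invformZr).
by rewrite (invformC one z)//; ring.
Qed.

Lemma normal_density_kernS q (S : 'M[R]_q) z v u : 0 < v -> posdefmx S ->
  normal_density (const_mx u) (v ^+ 2 *: S) z = kernS S z v u.
Proof.
move=> v0 S_pd; have v20 : 0 < v ^+ 2 by rewrite exprn_gt0.
rewrite /normal_density /kernS /kern /kern_const; congr (_ * expR _).
  rewrite detZ mulrCA sqrtrM ?exprn_ge0 ?ltW// -exprM mulnC exprM.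
  by rewrite sqrtr_sqr normrX (gtr0_norm v0) invfM mulrC.
rewrite invform_scale ?gt_eqF ?posdef_unit// invform_shift// mulNr.
by congr (- _); field; rewrite gt_eqF.
Qed.

(* The exponent is a positive semidefinite quadratic form. *)
Lemma kernS_le q (S : 'M[R]_q) z e v u : posdefmx S -> 0 < e -> e <= v ->
  kernS S z v u <= kern_const S * e ^- q.
Proof.
move=> S_pd e0 ev; have v0 := lt_le_trans e0 ev.
rewrite /kernS /kern -invform_shift// -[leRHS]mulr1.
have K0 := kern_const_gt0 S_pd.
rewrite ler_pM ?expR_ge0 ?mulr_ge0 ?invr_ge0 ?exprn_ge0 ?(ltW K0)//.
- rewrite ler_pM2l// lef_pV2 ?posrE ?exprn_gt0 ?normr_gt0 ?gt_eqF//.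
  by rewrite lerXn2r ?nnegrE ?(ltW e0) ?gtr0_norm ?(ltW v0).
- by rewrite expR_le1 oppr_le0 divr_ge0 ?invform_ge0// mulr_ge0// sqr_ge0.
Qed.

(** As a function of u the kernel is an unnormalized Gaussian of mean B / c and standard deviation v
    / sqrt c. Its integral is proportional to v, which lowers the power of 1/v by one. *)
Lemma integral_kern_line N K Q B c v : 0 <= K -> 0 < c -> 0 < v ->
  (\int[leb]_u (kern N.+1 K Q B c v u)%:E =
   (K * Num.sqrt (2 * pi / c) *
     (v ^- N * expR (- ((Q - B ^+ 2 / c) / (2 * v ^+ 2)))))%:E)%E.
Proof.
move=> K0 c0 v0; have sc0 : 0 < Num.sqrt c by rewrite sqrtr_gt0.
have s0 : 0 < v / Num.sqrt c by rewrite divr_gt0.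
pose r := Q - B ^+ 2 / c.
pose a := K * v ^- N.+1 * expR (- (r / (2 * v ^+ 2))).
have a0 : 0 <= a by rewrite !mulr_ge0 ?expR_ge0// invr_ge0 exprn_ge0// ltW.
transitivity (\int[leb]_u (a%:E * (normal_fun (B / c) (v / Num.sqrt c) u)%:E))%E.
  apply: eq_integral => u _; rewrite -EFinM /kern /a /normal_fun gtr0_norm//.
  congr EFin; rewrite -[RHS]mulrA -expRD; congr (_ * expR _).
  rewrite expr_div_n sqr_sqrtr ?(ltW c0)// /r -mulr_natl.
  by field; rewrite !gt_eqF.
rewrite ge0_integralZl//=; last 2 first.
- by apply/measurable_EFinP; exact: measurable_normal_fun.
- by move=> u _; rewrite lee_fin normal_fun_ge0.
rewrite integral_normal_fun ?gt_eqF// -EFinM; congr (_%:E).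
rewrite expr_div_n sqr_sqrtr ?(ltW c0)//.
have -> : v ^+ 2 / c * pi *+ 2 = v ^+ 2 * (2 * pi / c).
  by rewrite -mulr_natl; field; rewrite gt_eqF.
rewrite sqrtrM ?exprn_ge0 ?ltW// sqrtr_sqr gtr0_norm// /a exprS invfM -/r.
set E := expR _; set Z := v ^- N; set s := Num.sqrt _.
by field; rewrite gt_eqF.
Qed.

(** Two degrees of freedom are lost from the dimension k + 2: one in the integration over u, one
    because v^-(k+1) is the integrand leading to Gamma (k / 2). *)
Lemma integral_kern_plane k K Q B c : (0 < k)%N -> 0 <= K -> 0 < c ->
  0 < Q - B ^+ 2 / c ->
  (\int[leb]_(v in `]0%R, +oo[) \int[leb]_u (kern k.+2 K Q B c v u)%:E =
   (K * Num.sqrt (2 * pi / c) *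
     (Gamma (k%:R / 2) / (2 * ((Q - B ^+ 2 / c) / 2) `^ (k%:R / 2))))%:E)%E.
Proof.
move=> k0 K0 c0 r0.
rewrite [RHS]EFinM -integral_inverse_gamma// -ge0_integralZl//=.
- apply: eq_integral => v; rewrite inE/= in_itv/= andbT => v0.
  by rewrite integral_kern_line.
- by apply/measurable_EFinP/measurable_funTS; exact: measurable_exprV_expRV.
- move=> v; rewrite in_itv/= andbT => v0.
  by rewrite lee_fin mulr_ge0 ?expR_ge0// invr_ge0 exprn_ge0// ltW.
- by rewrite lee_fin mulr_ge0.
Qed.

End kernel.

(** * Limits of the mixtures *)

Section mixture.
Variable R : realType.
Local Notation leb := (@lebesgue_measure R).
Local Notation one := (const_mx 1).

Lemma measurable_invform d (T : measurableType d) q (S : 'M[R]_q)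
    (a b : T -> 'rV[R]_q) :
  (forall i, measurable_fun setT (fun x => a x 0 i)) ->
  (forall i, measurable_fun setT (fun x => b x 0 i)) ->
  measurable_fun setT (fun x => invform S (a x) (b x)).
Proof.
move=> ma mb.
rewrite (_ : (fun x => _) =
  fun x => \sum_j (\sum_i a x 0 i * invmx S i j) * b x 0 j).
  apply: measurable_sum => j; apply: measurable_funM => //.
  by apply: measurable_sum => i; exact: measurable_funM.
apply/funext => x; rewrite /invform mxE; apply: eq_bigr => j _.
by rewrite !mxE.
Qed.

Lemma measurable_kernS d (T : measurableType d) q (S : 'M[R]_q)
    (z : T -> 'rV[R]_q) (v u : T -> R) :
  (forall i, measurable_fun setT (fun x => z x 0 i)) ->
  measurable_fun setT v -> measurable_fun setT u ->
  measurable_fun setT (fun x => (kernS S (z x) (v x) (u x))%:E).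
Proof.
move=> mz mv mu; apply/measurable_EFinP; apply: measurable_kern => //;
  exact: measurable_invform.
Qed.

(** The prior density without its normalization, kept extended-real-valued for monotone convergence
    and Tonelli's theorem. *)
Definition mix q (S : 'M[R]_q) (z : 'rV[R]_q) (m e : R) : \bar R :=
  (\int[leb]_(v in `[e, e^-1%R]) \int[leb]_(u in `[(- m)%R, m%R]) (kernS S z v u)%:E)%E.

Section fixed.
Variables (q : nat) (S : 'M[R]_q) (z : 'rV[R]_q).
Hypothesis S_pd : posdefmx S.

Let k0 v u : (0 <= (kernS S z v u)%:E)%E.
Proof. by rewrite lee_fin kernS_ge0. Qed.

Let mk2 : measurable_fun setT
  (fun vu : measurableTypeR R * measurableTypeR R => (kernS S z vu.1 vu.2)%:E).
Proof. exact: measurable_kernS. Qed.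

Let mk v : measurable_fun setT (fun u : measurableTypeR R => (kernS S z v u)%:E).
Proof. exact: measurable_kernS. Qed.

Let minner (U : set (measurableTypeR R)) : measurable U ->
  measurable_fun setT (fun v => \int[leb]_(u in U) (kernS S z v u)%:E)%E.
Proof.
move=> mU.
exact: (@measurable_fun_integral_section _ _ _ _ R leb (fun v u => (kernS S z v u)%:E)).
Qed.

Lemma mix_ge0 m e : (0 <= mix S z m e)%E.
Proof. by do 2 apply: integral_ge0 => ? _. Qed.

Lemma integral_kernS_le m e v : 0 < e -> e <= v ->
  (\int[leb]_(u in `[(- m)%R, m%R]) (kernS S z v u)%:E <=
   (kern_const S * e ^- q)%:E * leb `[(- m)%R, m%R])%E.
Proof.
move=> e0 ev; rewrite -integral_cst//; apply: ge0_le_integral => //.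
- exact: measurable_funTS.
- by move=> u _; rewrite lee_fin kernS_le.
Qed.

Lemma itv_leb_lty (a b : R) : (leb `[a, b]%classic < +oo)%E.
Proof. by rewrite lebesgue_measure_itv/=; case: ifP => // _; rewrite -EFinB ltry. Qed.

Let c0 e : 0 < e -> (0 <= (kern_const S * e ^- q)%:E)%E.
Proof.
move=> e0; rewrite lee_fin mulr_ge0 ?(ltW (kern_const_gt0 S_pd))//.
by rewrite invr_ge0 exprn_ge0// ltW.
Qed.

Lemma integral_kernS_fin m e v : 0 < e -> e <= v ->
  (\int[leb]_(u in `[(- m)%R, m%R]) (kernS S z v u)%:E)%E \is a fin_num.
Proof.
move=> e0 ev; rewrite ge0_fin_numE ?integral_ge0//.
by rewrite (le_lt_trans (integral_kernS_le _ e0 ev))// lte_mul_pinfty ?c0// itv_leb_lty.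
Qed.

(** For v >= e the kernel is bounded by its constant times e^-q, and the rectangle has finite
    area. *)
Lemma mix_fin m e : 0 < e -> mix S z m e \is a fin_num.
Proof.
move=> e0; rewrite ge0_fin_numE ?mix_ge0//.
pose C : \bar R := ((kern_const S * e ^- q)%:E * leb `[(- m)%R, m%R])%E.
have Cfin : C \is a fin_num.
  by rewrite ge0_fin_numE ?mule_ge0 ?c0// lte_mul_pinfty ?c0// itv_leb_lty.
apply: (@le_lt_trans _ _ (\int[leb]_(v in `[e, e^-1%R]) (fine C)%:E)%E).
  apply: ge0_le_integral => //.
  - by move=> v _; exact: integral_ge0.
  - by apply: measurable_funTS; exact: minner.
  - move=> v /=; rewrite in_itv/= => /andP[ev _].
    by rewrite fineK//; exact: integral_kernS_le.
rewrite integral_cst// lte_mul_pinfty ?itv_leb_lty// lee_fin fine_ge0//.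
by rewrite mule_ge0// c0.
Qed.

(** [prior_density] nests two real-valued integrals; the inner one is also an extended one because
    it is finite for v >= e. *)
Lemma prior_densityE m e : 0 < e ->
  prior_density m e S z = (2 * m)^-1 * (e^-1 - e)^-1 * fine (mix S z m e).
Proof.
move=> e0; congr (_ * fine _); apply: eq_integral => v.
rewrite inE/= in_itv/= => /andP[ev _]; have v0 := lt_le_trans e0 ev.
rewrite -(fineK (integral_kernS_fin m e0 ev)); congr (fine _)%:E.
by apply: eq_integral => u _; rewrite normal_density_kernS.
Qed.

Lemma le_mix m m' e e' : m <= m' -> 0 < e' -> e' <= e ->
  (mix S z m e <= mix S z m' e')%E.
Proof.
move=> mm' e'0 e'e; have e0 := lt_le_trans e'0 e'e.
apply: (@le_trans _ _ (mix S z m' e)).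
  apply: ge0_le_integral => //.
  - by move=> v _; exact: integral_ge0.
  - by apply: measurable_funTS; exact: minner.
  - by apply: measurable_funTS; exact: minner.
  - move=> v _; apply: ge0_subset_integral => //.
      exact: measurable_funTS.
    move=> u /=; rewrite !in_itv/= => /andP[mu um].
    by rewrite (le_trans _ mu) ?lerN2//= (le_trans um).
apply: ge0_subset_integral => //.
- by apply: measurable_funTS; exact: minner.
- by move=> v _; exact: integral_ge0.
- move=> v /=; rewrite !in_itv/= => /andP[ev ve].
  by rewrite (le_trans _ ev)//= (le_trans ve)// lef_pV2.
Qed.

(** The kernel has a positive lower bound [b] on the rectangle: [M] dominates the exponent since |u|
    <= m and v >= e, and the power of v is bounded below since v <= 1/e. *)
Lemma mix_gt0 m e : 0 < m -> 0 < e -> e < 1 -> (0 < mix S z m e)%E.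
Proof.
move=> m0 e0 e1.
have ee : e < e^-1 by rewrite (lt_trans e1)// invf_gt1.
pose Q := invform S z z; pose B := invform S z one; pose c := invform S one one.
pose M := (`|Q| + 2 * m * `|B| + m ^+ 2 * `|c|) / (2 * e ^+ 2).
pose b := kern_const S * (e^-1) ^- q * expR (- M).
have b0 : 0 < b by rewrite !mulr_gt0 ?kern_const_gt0 ?expR_gt0 ?invr_gt0 ?exprn_gt0 ?invr_gt0.
have bk v u : v \in `[e, e^-1] -> u \in `[- m, m] -> b <= kernS S z v u.
  rewrite !in_itv/= => /andP[ev ve] /andP[mu um].
  have v0 := lt_le_trans e0 ev.
  rewrite /kernS /kern ler_pM ?expR_ge0 ?mulr_ge0 ?invr_ge0 ?exprn_ge0//
    ?invr_ge0 ?(ltW e0) ?(ltW (kern_const_gt0 _))//.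
    rewrite ler_pM2l ?kern_const_gt0//.
    rewrite lef_pV2 ?posrE ?exprn_gt0 ?invr_gt0 ?normr_gt0 ?gt_eqF//.
    by rewrite lerXn2r ?nnegrE ?invr_ge0 ?(ltW e0)// gtr0_norm.
  rewrite ler_expR lerN2 -/Q -/B -/c.
  have um' : `|u| <= m by rewrite ler_norml mu um.
  apply: (@le_trans _ _ ((`|Q| + 2 * m * `|B| + m ^+ 2 * `|c|) / (2 * v ^+ 2))).
    rewrite ler_pM2r ?invr_gt0 ?mulr_gt0 ?exprn_gt0//.
    apply: (le_trans (ler_norm _)); apply: (le_trans (ler_normD _ _)).
    apply: lerD; last first.
      by rewrite normrM normrX ler_wpM2r// lerXn2r ?nnegrE// ltW.
    apply: (le_trans (ler_normB _ _)); rewrite lerD2l !normrM ger0_norm//.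
    by rewrite -!mulrA ler_pM2l// ler_wpM2r.
  rewrite ler_wpM2l ?addr_ge0 ?mulr_ge0 ?exprn_ge0 ?(ltW m0)//.
  by rewrite lef_pV2 ?posrE ?mulr_gt0 ?exprn_gt0// ler_pM2l//
    lerXn2r ?nnegrE ?(ltW e0) ?(ltW v0).
apply: (@lt_le_trans _ _ (\int[leb]_(v in `[e, e^-1%R]) (b * (m - - m))%:E)%E).
  rewrite integral_cst//= lebesgue_measure_itv/= lte_fin ee -EFinB -EFinM lte_fin.
  have mm : - m < m by rewrite gtrN.
  by apply: mulr_gt0; [apply: mulr_gt0|]; rewrite ?subr_gt0.
apply: ge0_le_integral => //.
- by move=> v _; rewrite lee_fin mulr_ge0 ?(ltW b0)// opprK addr_ge0 ?ltW.
- by apply: measurable_funTS; exact: minner.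
- move=> v ve; apply: (@le_trans _ _ (\int[leb]_(u in `[(- m)%R, m%R]) b%:E)%E).
    by rewrite integral_cst//= lebesgue_measure_itv/= lte_fin gtrN// -EFinB -EFinM.
  apply: ge0_le_integral => //.
  + by move=> u _; rewrite lee_fin ltW.
  + exact: measurable_funTS.
  + by move=> u um; rewrite lee_fin bk.
Qed.

Lemma mix_cvg_seq : mix S z n.+1%:R n.+1%:R^-1 @[n --> \oo] -->
  (\int[leb]_(v in `]0%R, +oo[) \int[leb]_u (kernS S z v u)%:E)%E.
Proof.
pose E n : set (measurableTypeR R) := `[n.+1%:R^-1, n.+1%:R : R]%classic.
pose U n : set (measurableTypeR R) := `[- n.+1%:R, n.+1%:R : R]%classic.
pose I n v := (\int[leb]_(u in U n) (kernS S z v u)%:E)%E.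
(* Both domains vary with n. Extending by 0 outside [E n] puts the outer integrals on a fixed
   domain, where monotone convergence applies; the inner limit is monotone in the sets [U n]. *)
pose g n v := ((I n) \_ (E n)) v.
have I0 n v : (0 <= I n v)%E by exact: integral_ge0.
have mU n : measurable (U n) by exact: measurable_itv.
have mE n : measurable (E n) by exact: measurable_itv.
have Un : nondecreasing_seq U.
  move=> i j ij; rewrite subsetEset => u; rewrite /U /= !in_itv/= => /andP[lu ul].
  by rewrite (le_trans _ lu) ?lerN2 ?ler_nat//= (le_trans ul)// ler_nat.
have Imono i j v : (i <= j)%N -> (I i v <= I j v)%E.
  move=> ij; apply: ge0_subset_integral => //; first exact: measurable_funTS.
  by apply/subsetPset; exact: Un.
have Icvg v : I n v @[n --> \oo] --> (\int[leb]_u (kernS S z v u)%:E)%E.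
  rewrite (_ : setT = \bigcup_n U n).
    apply: (@ge0_nondecreasing_set_cvg_integral _ (measurableTypeR R) R U _ leb) => //.
    by move=> i; exact: measurable_funTS.
  apply/esym; rewrite -subTset => u _; exists (Num.truncn `|u|) => //.
  by rewrite /U /= in_itv/= -ler_norml ltW// truncnS_gt.
have mg n : measurable_fun setT (g n).
  by apply/(measurable_restrictT _ (mE n)); apply: measurable_funTS; exact: minner.
have g0 n v : setT v -> (0 <= g n v)%E by move=> _; rewrite /g patchE; case: ifP.
have gmono v : setT v -> {homo g^~ v : i j / (i <= j)%N >-> (i <= j)%E}.
  move=> _ i j ij; rewrite /g !patchE; case: ifPn => vi; last by case: ifP.
  rewrite ifT ?Imono//; move: vi; rewrite !inE; apply/subsetPset.
  exact: nondecreasing_itv_inv.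
have := @cvg_monotone_convergence _ _ _ leb _ measurableT g mg g0 gmono.
rewrite (_ : (fun n => _) = (fun n => mix S z n.+1%:R n.+1%:R^-1)); last first.
  by apply/funext => n; rewrite /mix invrK [RHS]integral_mkcond.
rewrite [X in _ --> X -> _](_ : _ =
  (\int[leb]_(v in `]0%R, +oo[) \int[leb]_u (kernS S z v u)%:E)%E)//.
rewrite [RHS]integral_mkcond; apply: eq_integral => v _.
rewrite patchE; case: ifPn => v0; last first.
  apply: lim_near_cst => //; apply: nearW => n; rewrite /g patchE ifN//.
  apply: contra v0; rewrite !inE /E /= !in_itv/= andbT => /andP[nv _].
  by rewrite (lt_le_trans _ nv)// invr_gt0 ltr0n.
apply/cvg_lim => //; apply: cvg_trans (Icvg v).
move: v0; rewrite inE -bigcup_itv_inv => -[N _ vN].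
apply: near_eq_cvg; near=> n; rewrite /g patchE ifT// inE.
have /subsetPset : E N `<=` E n.
  by apply/subsetPset; apply: nondecreasing_itv_inv; near: n; exists N.
by move/subsetPset; apply.
Unshelve. all: by end_near. Qed.

End fixed.

Lemma measurable_mix d (T : measurableType d) q (S : 'M[R]_q) (z : T -> 'rV[R]_q) m e :
  posdefmx S -> (forall i, measurable_fun setT (fun t => z t 0 i)) ->
  measurable_fun setT (fun t => mix S (z t) m e).
Proof.
move=> S_pd mz.
apply: (@measurable_fun_integral_section _ _ _ _ R leb
  (fun t v => \int[leb]_(u in `[(- m)%R, m%R]) (kernS S (z t) v u)%:E)%E) => //.
- apply: (@measurable_fun_integral_section _ _
    (T * measurableTypeR R)%type _ R leb
    (fun tv u => (kernS S (z tv.1) tv.2 u)%:E)) => //.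
  + apply: measurable_kernS => //.
    * by move=> i; apply: (measurableT_comp (mz i)); exact: measurableT_comp.
    * by apply: measurableT_comp.
  + by move=> tv u; rewrite lee_fin kernS_ge0.
- by move=> t v; apply: integral_ge0 => u _; rewrite lee_fin kernS_ge0.
Qed.

End mixture.

(** * Identification of the limit as a Student distribution *)

Section limit.
Variable R : realType.
Local Notation leb := (@lebesgue_measure R).
Local Notation one := (const_mx 1).

(** Closed form of the kernel's integral over all u and all v > 0 when q = k + 2; [k] is kept
    separate to avoid subtraction on naturals. *)
Definition mix_lim (k : nat) q (S : 'M[R]_q) (z : 'rV[R]_q) : R :=
  kern_const S * Num.sqrt (2 * pi / invform S one one) *
  (Gamma (k%:R / 2) / (2 * (residual S z / 2) `^ (k%:R / 2))).

Lemma mix_lim_gt0 k q (S : 'M[R]_q) z : (0 < k)%N -> (0 < q)%N -> posdefmx S ->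
  0 < residual S z -> 0 < mix_lim k S z.
Proof.
move=> k0 q0 S_pd r0; apply: mulr_gt0; first apply: mulr_gt0.
- exact: kern_const_gt0.
- by rewrite sqrtr_gt0 divr_gt0 ?mulr_gt0 ?pi_gt0// invform_one_gt0.
- by rewrite divr_gt0 ?Gamma_half_gt0// mulr_gt0// powR_gt0// divr_gt0.
Qed.

Lemma integral_kernS k q (S : 'M[R]_q) z : (0 < k)%N -> q = k.+2 -> posdefmx S ->
  0 < residual S z ->
  (\int[leb]_(v in `]0%R, +oo[) \int[leb]_u (kernS S z v u)%:E = (mix_lim k S z)%:E)%E.
Proof.
move=> k0 qE S_pd r0; rewrite -(integral_kern_plane k0 _ _ r0).
- apply: eq_integral => v _; apply: eq_integral => u _; rewrite /kernS.
  by congr (kern _ _ _ _ _ _ _)%:E.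
- exact/ltW/kern_const_gt0.
- by apply: invform_one_gt0 => //; rewrite qE.
Qed.

Lemma near_pinfty_right0 : \forall me \near (+oo, (0 : R)^'+),
  [/\ (0 : R) < me.1, 0 < me.2 & me.2 < 1].
Proof.
apply: filter_pair_near_of => x y xn yn /=; split.
- by near: x; exact: nbhs_pinfty_gt.
- by near: y; exact: nbhs_right_gt.
- by near: y; exact: nbhs_right_lt.
Unshelve. all: by end_near. Qed.

Lemma mix_cvg k q (S : 'M[R]_q) z : (0 < k)%N -> q = k.+2 -> posdefmx S ->
  0 < residual S z ->
  mix S z me.1 me.2 @[me --> (+oo, (0 : R)^'+)] --> (mix_lim k S z)%:E.
Proof.
move=> k0 qE S_pd r0; apply: cvge_pinfty_right0_monotone.
  by move=> *; exact: le_mix.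
by rewrite -integral_kernS//; exact: mix_cvg_seq.
Qed.

Lemma powR_half (a : R) n : 0 <= a -> a `^ (n%:R / 2) = Num.sqrt (a ^+ n).
Proof. by move=> a0; rewrite powRrM powR_mulrn// powR12_sqrt// exprn_ge0. Qed.

Lemma sqrtr_exprn (a : R) n : 0 <= a -> Num.sqrt a ^+ n = Num.sqrt (a ^+ n).
Proof.
move=> a0; elim: n => [|n IH]; first by rewrite !expr0 sqrtr1.
by rewrite !exprS IH sqrtrM.
Qed.

Section student.
Variables (p n k : nat) (A : 'M[R]_p) (B : 'M[R]_(p, n)) (C : 'M[R]_n).
Variable y : 'rV[R]_n.
Hypotheses (T_pd : posdefmx (block_mx A B B^T C)) (k_gt0 : (0 < k)%N).
Hypotheses (nE : n = k.+2) (y_nonconst : ~ exists c, y = const_mx c).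
Let T := block_mx A B B^T C.
Let C_pd := posdef_dr T_pd.
Let n_gt0 : (0 < n)%N. Proof. by rewrite nE. Qed.
Let r := residual C y.
Let r_gt0 : 0 < r. Proof. exact: residual_gt0. Qed.

Let M := post_scale A B C.
Let loc := post_loc B C y.
Let M_pd : posdefmx M := post_scale_posdef T_pd n_gt0.

Definition student_scale : 'M[R]_p := (r / k%:R) *: M.

Lemma student_scale_posdef : posdefmx student_scale.
Proof. by apply: posdef_scale => //; rewrite divr_gt0// ltr0n. Qed.

Let rT t : residual T (row_mx t y) = r + invform M (t - loc) (t - loc).
Proof. exact: residual_block. Qed.

Let rT_gt0 t : 0 < residual T (row_mx t y).
Proof. by rewrite rT ltr_wpDr// invform_ge0. Qed.

Let dimT : (p + n)%N = (k + p).+2. Proof. by rewrite nE addnC !addSn. Qed.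

Let kp_gt0 : (0 < k + p)%N. Proof. by rewrite ltn_addr. Qed.

(** The determinant identity compares the constants, and the residual identity factors (s + x) / 2
    as s / 2 times the base of the Student power; the surplus (s / 2)^(p/2) is absorbed by the
    determinant of the scale matrix. *)
Lemma mix_lim_student t :
  mix_lim (k + p) T (row_mx t y) =
  mix_lim k C y * student_density k loc student_scale t.
Proof.
rewrite /mix_lim /student_density /student_scale rT -!/r.
move: r_gt0; generalize r => s s_gt0.
set x := invform M _ _; have x0 : 0 <= x by exact: invform_ge0.
have k0 : 0 < k%:R :> R by rewrite ltr0n.
have -> : invform (((s / k%:R) *: M)) (t - loc) (t - loc) = k%:R / s * x.
  by rewrite invform_scale ?posdef_unit ?invf_div// gt_eqF// divr_gt0.
set cT := invform T _ _; set cC := invform C _ _.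
have cT0 : 0 < cT by apply: invform_one_gt0 => //; rewrite addn_gt0 n_gt0 orbT.
have cC0 : 0 < cC by exact: invform_one_gt0.
have dM0 := posdef_det_gt0 M_pd; have dC0 := posdef_det_gt0 C_pd.
have dT0 := posdef_det_gt0 T_pd.
have pi2 : 0 < 2 * pi :> R by rewrite mulr_gt0// pi_gt0.
have detE : kern_const T * Num.sqrt (2 * pi / cT) =
    kern_const C * Num.sqrt (2 * pi / cC) / Num.sqrt ((2 * pi) ^+ p * \det M).
  have sV (a : R) : 0 <= a -> (Num.sqrt a)^-1 = Num.sqrt a^-1 by move=> a0; rewrite sqrtrV.
  rewrite /kern_const !sV ?mulr_ge0 ?exprn_ge0 ?mulr_ge0 ?pi_ge0
    ?(ltW dM0) ?(ltW dC0) ?(ltW dT0) ?(ltW cT0) ?(ltW cC0)//.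
  rewrite -!sqrtrM ?mulr_ge0 ?invr_ge0 ?mulr_ge0 ?exprn_ge0 ?mulr_ge0 ?pi_ge0
    ?(ltW dM0) ?(ltW dC0) ?(ltW dT0) ?(ltW cT0) ?(ltW cC0)//.
  congr Num.sqrt; have := det_block T_pd n_gt0; rewrite -/T -/cT -/cC -/M => E.
  have -> : \det T = \det M * (\det C * cC) / cT by rewrite -E mulfK// gt_eqF.
  have [P0 N0] : (2 * pi) ^+ p != 0 :> R /\ (2 * pi) ^+ n != 0 :> R.
    by rewrite !gt_eqF ?exprn_gt0.
  rewrite exprD; move: P0 N0; set P := _ ^+ p; set N := _ ^+ n => P0 N0.
  by field; rewrite P0 N0 !gt_eqF ?pi_gt0.
have powE : ((s + x) / 2) `^ ((k + p)%:R / 2) =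
    (s / 2) `^ (k%:R / 2) * Num.sqrt ((s / 2) ^+ p) *
    (1 + k%:R^-1 * (k%:R / s * x)) `^ ((k + p)%:R / 2).
  have -> : (s + x) / 2 = s / 2 * (1 + k%:R^-1 * (k%:R / s * x)).
    by field; rewrite !gt_eqF.
  rewrite powRM ?divr_ge0 ?addr_ge0 ?mulr_ge0 ?invr_ge0 ?divr_ge0 ?(ltW s_gt0) ?(ltW k0)//.
  congr (_ * _); rewrite natrD mulrDl powRD; last first.
    have -> : s / 2 != 0 by rewrite gt_eqF// divr_gt0.
    by rewrite implybT.
  by rewrite [in X in _ * X]powR_half// divr_ge0 ?ltW.
rewrite detE powE powRN.
set b := 1 + _; have b0 : 0 < b.
  by rewrite /b ltr_wpDr// !mulr_ge0 ?invr_ge0 ?(ltW s_gt0) ?(ltW k0).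
have bp0 : 0 < b `^ ((k + p)%:R / 2) by rewrite powR_gt0.
have rp0 : 0 < (s / 2) `^ (k%:R / 2) by rewrite powR_gt0// divr_gt0.
have G0 : 0 < Gamma (k%:R / 2 : R) by exact: Gamma_half_gt0.
(* The determinant of (s / k) M is (s / k)^p det M, and the powers of k cancel. *)
have sE : Num.sqrt (pi * k%:R) ^+ p * Num.sqrt (\det (((s / k%:R) *: M))) =
    Num.sqrt ((2 * pi) ^+ p * \det M) * Num.sqrt ((s / 2) ^+ p).
  rewrite sqrtr_exprn ?mulr_ge0 ?pi_ge0// detZ.
  rewrite -!sqrtrM ?mulr_ge0 ?exprn_ge0 ?mulr_ge0 ?pi_ge0
    ?(ltW dM0)//.
  congr Num.sqrt; rewrite [LHS]mulrA -[in LHS]exprMn [RHS]mulrAC -[in RHS]exprMn.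
  congr (_ ^+ _ * _).
  by field; rewrite gt_eqF.
rewrite sE.
have s1 : 0 < Num.sqrt ((2 * pi) ^+ p * \det M).
  by rewrite sqrtr_gt0 mulr_gt0// exprn_gt0.
have s2 : 0 < Num.sqrt ((s / 2) ^+ p) by rewrite sqrtr_gt0 exprn_gt0// divr_gt0.
move: s1 s2 bp0 rp0 G0.
set s1 := Num.sqrt (_ * \det M); set s2 := Num.sqrt ((s / 2) ^+ p).
set bp := b `^ _; set rp := (s / 2) `^ _; set G := Gamma (k%:R / 2).
set G' := Gamma _; set s3 := Num.sqrt (_ / cC); set kc := kern_const C.
move=> s10 s20 bp0 rp0 G0.
by field; rewrite !gt_eqF.
Qed.

Let post m e t := prior_density m e T (row_mx t y) / prior_density m e C y.

Let postE m e t : 0 < m -> 0 < e -> e < 1 ->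
  (post m e t)%:E = (mix T (row_mx t y) m e * ((fine (mix C y m e))^-1)%:E)%E.
Proof.
move=> m0 e0 e1; rewrite /post !prior_densityE// -[in RHS](fineK (mix_fin _ T_pd m e0)).
rewrite -EFinM; congr EFin.
have ee : e^-1 - e != 0 by rewrite gt_eqF// subr_gt0 (lt_trans e1)// invf_gt1.
have f0 : fine (mix C y m e) != 0.
  by rewrite gt_eqF// fine_gt0// mix_gt0// ltey_eq mix_fin.
by rewrite -mulf_div mulfV ?mul1r// mulf_neq0// invr_eq0// gt_eqF// mulr_gt0.
Qed.

Let mixC_cvg : (fine (mix C y me.1 me.2))^-1
  @[me --> (+oo, (0 : R)^'+)] --> (mix_lim k C y)^-1.
Proof.
apply: cvgV; first by rewrite gt_eqF// mix_lim_gt0.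
exact: (fine_cvg (mix_cvg k_gt0 nE C_pd r_gt0)).
Qed.

Lemma post_cvg t : post me.1 me.2 t @[me --> (+oo, (0 : R)^'+)] -->
  student_density k loc student_scale t.
Proof.
have mC0 : 0 < mix_lim k C y by exact: mix_lim_gt0.
rewrite (_ : student_density _ _ _ _ = mix_lim (k + p) T (row_mx t y) / mix_lim k C y).
  apply: (@cvg_trans _ ((fine (mix T (row_mx t y) me.1 me.2) *
     (fine (mix C y me.1 me.2))^-1) @[me --> (+oo, (0 : R)^'+)])).
    apply: near_eq_cvg; have := near_pinfty_right0; apply: filterS => -[m e] /= [m0 e0 e1].
    by apply: EFin_inj; rewrite postE// EFinM fineK// mix_fin.
  exact: (cvgM (fine_cvg (mix_cvg kp_gt0 dimT T_pd (rT_gt0 t))) mixC_cvg).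
by rewrite mix_lim_student mulrAC mulfV ?mul1r// gt_eqF.
Qed.

Local Notation lam := (@lebesgue_tuple R p).

Let row (t : tupleR R p) := row_mx (rV_of t) y.

Lemma measurable_rV_of i : measurable_fun setT (fun t : tupleR R p => rV_of t 0 i).
Proof.
rewrite (_ : (fun t => _) = (fun t : tupleR R p => tnth t i)).
  exact: measurable_tnth.
by apply/funext => t; rewrite mxE.
Qed.

Let measurable_row i : measurable_fun setT (fun t => row t 0 i).
Proof.
rewrite -(splitK i); case: (fintype.split i) => j /=.
  by under eq_fun do rewrite /row row_mxEl; exact: measurable_rV_of.
by under eq_fun do rewrite /row row_mxEr; exact: measurable_cst.
Qed.

Let measurable_mix_row m e : measurable_fun setT (fun t => mix T (row t) m e).
Proof. exact: measurable_mix. Qed.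

Let mixA (S : set (tupleR R p)) m e := (\int[lam]_(t in S) mix T (row t) m e)%E.

Let measurable_mix_lim : measurable_fun setT (fun t => mix_lim (k + p) T (row t)).
Proof.
have mq : measurable_fun setT (fun t => residual T (row t)).
  apply: measurable_funB; first exact: measurable_invform.
  by apply: measurable_funM => //; apply: measurable_funX; exact: measurable_invform.
apply: measurable_funM => //; apply: measurable_funM => //.
apply: (measurableT_comp (@measurable_invr R)); apply: measurable_funM => //.
apply: (@measurableT_comp _ _ _ _ _ _ (@powR R ^~ ((k + p)%:R / 2))) => //.
exact: measurable_funM.
Qed.

(** The integral over S inherits the monotonicity in m and e, so a second monotone convergence, now
    in t and along the diagonal, suffices. *)
Let mixA_cvg S : measurable S -> mixA S me.1 me.2 @[me --> (+oo, (0 : R)^'+)] -->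
  (\int[lam]_(t in S) (mix_lim (k + p) T (row t))%:E)%E.
Proof.
move=> mS; apply: cvge_pinfty_right0_monotone.
  move=> m m' e e' mm' e'0 e'e; apply: ge0_le_integral; first exact: mS.
  - by move=> t _; exact: mix_ge0.
  - exact: (measurable_funTS (measurable_mix_row _ _)).
  - exact: (measurable_funTS (measurable_mix_row _ _)).
  - by move=> t _; exact: le_mix.
pose g n t := mix T (row t) n.+1%:R n.+1%:R^-1.
have := @cvg_monotone_convergence _ _ _ lam S mS g.
rewrite (_ : (\int[lam]_(t in S) limn (g^~ t))%E =
  (\int[lam]_(t in S) (mix_lim (k + p) T (row t))%:E)%E); last first.
  apply: eq_integral => t _; apply/cvg_lim => //.
  rewrite -integral_kernS//; first exact: mix_cvg_seq.
  exact: rT_gt0.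
apply.
- by move=> i; exact: (measurable_funTS (measurable_mix_row _ _)).
- by move=> i t _; exact: mix_ge0.
- move=> t _ i j ij; apply: le_mix => //; first by rewrite ler_nat.
  by rewrite lef_pV2 ?posrE ?ltr0n// ler_nat.
Qed.

Lemma post_set_cvg S : measurable S ->
  (\int[lam]_(t in S) (post me.1 me.2 (rV_of t))%:E)%E
    @[me --> (+oo, (0 : R)^'+)] -->
  (\int[lam]_(t in S) (student_density k loc student_scale (rV_of t))%:E)%E.
Proof.
move=> mS; have mC0 : 0 < mix_lim k C y by exact: mix_lim_gt0.
have rE : (\int[lam]_(t in S) (student_density k loc student_scale (rV_of t))%:E =
    (\int[lam]_(t in S) (mix_lim (k + p) T (row t))%:E) * ((mix_lim k C y)^-1)%:E)%E.
  rewrite -ge0_integralZr//.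
  - apply: eq_integral => t _; rewrite -EFinM /row mix_lim_student.
    by rewrite mulrAC mulfV ?mul1r// gt_eqF.
  - by apply/measurable_EFinP; exact: measurable_funTS.
  - move=> t _; rewrite lee_fin ltW// mix_lim_gt0//; last exact: rT_gt0.
    by rewrite dimT.
  - by rewrite lee_fin invr_ge0 ltW.
rewrite rE.
apply: (@cvg_trans _ ((mixA S me.1 me.2 * ((fine (mix C y me.1 me.2))^-1)%:E)%E
   @[me --> (+oo, (0 : R)^'+)])).
  apply: near_eq_cvg; have := near_pinfty_right0; apply: filterS => -[m e] /= [m0 e0 e1].
  rewrite /mixA -ge0_integralZr//.
  - by apply: eq_integral => t _; rewrite postE.
  - exact: measurable_funTS.
  - by move=> t _; exact: mix_ge0.
  - by rewrite lee_fin invr_ge0 fine_ge0// mix_ge0.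
have fC : (((fine (mix C y me.1 me.2))^-1)%:E)
    @[me --> (+oo, (0 : R)^'+)] --> ((mix_lim k C y)^-1)%:E.
  by apply: cvg_EFin; [exact: nearW|exact: mixC_cvg].
refine (cvgeM _ (mixA_cvg mS) fC).
(* In the extended reals the limit of a product requires the product of the limits to be defined; an
   infinite first limit is admissible as the second is nonzero. *)
have [If|If] := boolP
  ((\int[lam]_(t in S) (mix_lim (k + p) T (row t))%:E)%E \is a fin_num).
  by rewrite mule_def_fin.
by rewrite mule_def_infty_neq0// eqe invr_eq0 gt_eqF.
Qed.

End student.
End limit.

(** * The law of U + V W *)

(** Names the measure structure of the pushforward, which depends on the proof of measurability, so
    that it can be passed as a term. *)
Definition image_measure d1 d2 (T1 : measurableType d1) (T2 : measurableType d2)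
    (R : realType) (m : {measure set T1 -> \bar R}) (f : T1 -> T2)
    (mf : measurable_fun setT f) : {measure set T2 -> \bar R} :=
  measure_function_pushforward__canonical__measure_function_Measure m mf.

Lemma ge0_integral_image d1 d2 (T1 : measurableType d1) (T2 : measurableType d2)
    (R : realType) (m : {measure set T1 -> \bar R}) (f : T1 -> T2)
    (mf : measurable_fun setT f) (g : T2 -> \bar R) :
  measurable_fun setT g -> (forall y, 0 <= g y)%E ->
  (\int[image_measure m mf]_y g y = \int[m]_x g (f x))%E.
Proof.
by move=> mg g0; rewrite (ge0_integral_pushforward mf)// preimage_setT.
Qed.

(** * Lebesgue measure under t = u 1 + v w *)

Section affine_change_of_variables.
Variable R : realType.
Local Notation leb := (@lebesgue_measure R).
Variables (u v : R).
Hypothesis v_gt0 : 0 < v.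

Let phi (w : measurableTypeR R) : measurableTypeR R := u + v * w.

Let mphi : measurable_fun setT phi.
Proof. by apply: measurable_funD => //; exact: measurable_funM. Qed.

Let v_ge0 : 0 <= v := ltW v_gt0.

(** By uniqueness of Lebesgue measure it is enough to compare lengths of half-open intervals. *)
Let lebesgue_scaled (A : set (measurableTypeR R)) : measurable A ->
  leb A = mscale (NngNum v_ge0) (image_measure leb mphi) A.
Proof.
apply: lebesgue_measure_unique => X [[a b] _ <-] /=.
rewrite /mscale /= /pushforward.
have -> : phi @^-1` `]a, b] = `](a - u) / v, (b - u) / v]%classic.
  apply/seteqP; split => w /=; rewrite !in_itv/= ltr_pdivrMr// ler_pdivlMr//;
    by rewrite ltrBlDl lerBrDl mulrC.
rewrite !lebesgue_measure_itv/= !lte_fin ltr_pM2r ?invr_gt0// ltrD2r.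
case: ifPn => ab; last by rewrite mule0.
by rewrite -!EFinB -EFinM; congr EFin; field; rewrite gt_eqF.
Qed.

Lemma ge0_integral_affine (f : measurableTypeR R -> \bar R) :
  measurable_fun setT f -> (forall x, 0 <= f x)%E ->
  (\int[leb]_x f x = v%:E * \int[leb]_x f (u + v * x)%R)%E.
Proof.
move=> mf f0.
rewrite (eq_measure_integral (mscale (NngNum v_ge0) (image_measure leb mphi))).
  rewrite ge0_integral_mscale//; congr (_ * _)%E.
  exact: ge0_integral_image.
by move=> A mA _; exact: lebesgue_scaled.
Qed.

Definition affine_tuple q (t : tupleR R q) : tupleR R q :=
  map_tuple (fun x : R => u + v * x) t.

Lemma measurable_affine_tuple q : measurable_fun setT (@affine_tuple q).
Proof.
apply/measurable_fun_tnthP => i.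
rewrite (_ : _ \o _ = phi \o (fun t : tupleR R q => tnth t i)).
  by apply: measurableT_comp => //; exact: measurable_tnth.
by apply/funext => t /=; rewrite tnth_map.
Qed.

Lemma affine_tuple_cons q x (t : tupleR R q) :
  affine_tuple (consT (x, t)) = consT (u + v * x, affine_tuple t).
Proof. exact: val_inj. Qed.

Lemma ge0_integral_lebesgue_cons q (f : tupleR R q.+1 -> \bar R) :
  measurable_fun setT f -> (forall x, 0 <= f x)%E ->
  (\int[lebesgue_tuple q.+1]_t f t =
   \int[leb]_x \int[lebesgue_tuple q]_t f (consT (x, t)))%E.
Proof.
move=> mf f0.
transitivity (\int[image_measure (leb \x lebesgue_tuple q)%E
  (@measurable_consT R q)]_t f t)%E.
  by [].
rewrite ge0_integral_image// fubini_tonelli1//.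
by apply: measurableT_comp => //; exact: measurable_consT.
Qed.

(** Induction on the dimension, each coordinate contributing a factor v. *)
Lemma ge0_integral_affine_tuple q (f : tupleR R q -> \bar R) :
  measurable_fun setT f -> (forall x, 0 <= f x)%E ->
  (\int[lebesgue_tuple q]_t f t =
   (v ^+ q)%:E * \int[lebesgue_tuple q]_t f (affine_tuple t))%E.
Proof.
elim: q f => [|q IH] f mf f0.
  rewrite expr0 mul1e; apply: eq_integral => t _; congr (f _).
  by rewrite [LHS]tuple0 [RHS]tuple0.
have mfa : measurable_fun setT (f \o @affine_tuple q.+1).
  by apply: measurableT_comp => //; exact: measurable_affine_tuple.
have mfc : measurable_fun setT (fun xt => f (@consT R q xt)).
  by apply: measurableT_comp => //; exact: measurable_consT.
rewrite ge0_integral_lebesgue_cons// [in RHS]ge0_integral_lebesgue_cons//.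
under eq_integral => x _.
  rewrite IH//; last first.
    by apply: (@measurable_fun_pair2 _ _ _ _ _ _ (fun xt => f (consT xt))).
  over.
have mI : measurable_fun setT
    (fun x => \int[lebesgue_tuple q]_t f (consT (x, affine_tuple t)))%E.
  apply: (measurable_fun_fubini_tonelli_F (m2 := lebesgue_tuple q)
    (fun xt => f (consT (xt.1, affine_tuple xt.2)))) => //.
  apply: (@measurableT_comp _ _ _ _ _ _ (fun xt => f (@consT R q xt)) setT
    (fun xt : measurableTypeR R * tupleR R q => (xt.1, affine_tuple xt.2))) => //.
  apply/measurable_fun_pair => //; apply: measurableT_comp => //.
  exact: measurable_affine_tuple.
have I0 x : (0 <= \int[lebesgue_tuple q]_t f (consT (x, affine_tuple t)))%E.
  exact: integral_ge0.
rewrite ge0_integralZl//; last by rewrite lee_fin exprn_ge0.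
rewrite (ge0_integral_affine mI I0) muleA -EFinM exprSr; congr (_ * _)%E.
by apply: eq_integral => x _; apply: eq_integral => t _; rewrite /= affine_tuple_cons.
Qed.

End affine_change_of_variables.
Arguments affine_tuple {R} u v {q} t.

(** * A measure on a triple product is determined by the boxes *)

Section triple_product.
Local Open Scope ereal_scope.
Context d1 d2 d3 (T1 : measurableType d1) (T2 : measurableType d2)
  (T3 : measurableType d3) (R : realType).
Variables (m1 : probability T1 R) (m2 : probability T2 R) (m3 : probability T3 R).
Variable M : {measure set (T1 * (T2 * T3)) -> \bar R}.
Hypothesis M_box : forall A B C, measurable A -> measurable B -> measurable C ->
  M (A `*` (B `*` C)) = m1 A * (m2 B * m3 C).

Let m23 : subprobability (T2 * T3)%type R :=
  product_subprobability ((m2 : subprobability T2 R), (m3 : subprobability T3 R)).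

(** For fixed A both sides are finite measures in B ([N1] and [N2]) that agree on rectangles, a
    generating class stable under intersection. *)
Let box A (B : set (T2 * T3)) : measurable A -> measurable B ->
  M (A `*` B) = m1 A * m23 B.
Proof.
move=> mA mB.
have mAT : measurable (A `*` [set: T2 * T3]) by exact: measurableX.
pose N1 := image_measure (mrestr M mAT) (@measurable_snd _ _ T1 (T2 * T3)%type).
have fA : m1 A \is a fin_num by exact: fin_num_measure.
have A0 : (0 <= fine (m1 A))%R by rewrite fine_ge0.
pose N2 := mscale (NngNum A0) m23.
have N1E E : N1 E = M (A `*` E).
  rewrite /N1 /= /pushforward /mrestr; congr (M _).
  by apply/seteqP; split => -[x y] /=; tauto.
have N2E E : N2 E = m1 A * m23 E by rewrite /N2 /mscale /= fineK.
rewrite -N1E -N2E.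
apply: (measure_unique [set E `*` F | E in measurable & F in measurable]
  (fun=> setT)) => //.
- exact: measurable_prod_measurableType.
- move=> _ _ [E1 mE1 [F1 mF1 <-]] [E2 mE2 [F2 mF2 <-]].
  rewrite -setXI; exists (E1 `&` E2); first exact: measurableI.
  by exists (F1 `&` F2) => //; exact: measurableI.
- by move=> _; exists setT => //; exists setT => //; rewrite setXTT.
- by rewrite bigcup_const//; exists 0%N.
- move=> _ [E mE [F mF <-]]; rewrite [LHS]N1E [RHS]N2E M_box//.
  by congr (_ * _); rewrite [RHS]product_measure1E.
- move=> _; rewrite [X in X < _]N1E -setXTT M_box// !probability_setT !mule1.
  by rewrite ltey_eq fA.
Qed.

Lemma triple_product_unique S : measurable S ->
  M S = \int[m1]_x \int[m2]_y m3 [set z | S (x, (y, z))].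
Proof.
move=> mS.
rewrite -(@product_measure_unique _ _ _ _ _ m1 m23 M box)//.
apply: eq_integral => x _ /=; apply: eq_integral => y _ /=.
by congr (m3 _); apply/seteqP; split => z; rewrite /xsection /= !inE/= inE.
Qed.

End triple_product.

(* The same random variable, with the codomain on which Lebesgue measure is defined. *)
Definition borel_rv (R : realType) d (O : measurableType d) (P : probability O R)
    (Z : {RV P >-> R}) : {mfun O >-> measurableTypeR R} :=
  HB.pack (Z : O -> measurableTypeR R)
    (isMeasurableFun.Build _ _ _ (measurableTypeR R) (Z : O -> measurableTypeR R)
      (measurable_funP Z)).

(** * Joint law of U, V and a marginal of W *)

Section prior_law.
Variables (R : realType) (D : nat) (X : set 'rV[R]_D).
Variables (d : measure_display) (O : measurableType d) (P : probability O R).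
Variables (U V : {RV P >-> R}) (W : 'rV[R]_D -> {RV P >-> R}).
Variables (q : nat) (a : 'I_q -> 'rV[R]_D).
Hypothesis aX : forall i, X (a i).

Definition marginal (w : O) : tupleR R q := mktuple (fun i => W (a i) w).

Lemma measurable_marginal : measurable_fun setT marginal.
Proof.
apply/measurable_fun_tnthP => i; rewrite (_ : _ \o _ = (W (a i) : O -> R)).
  exact: (measurable_funP (W (a i))).
by apply/funext => w /=; rewrite tnth_mktuple.
Qed.

(** The sample space is re-equipped with the sigma-algebra generated by the field; each coordinate
    is measurable for it, hence so is the tuple. This allows independence to be applied to events of
    the whole marginal. *)
Lemma sigma_field_marginal (C : set (tupleR R q)) : measurable C ->
  sigma_field X W (marginal @^-1` C).
Proof.
move=> mC; pose G := \bigcup_(x in X) sigma_rv (W x).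
pose f : g_sigma_algebraType G -> tupleR R q := marginal.
have mf : measurable_fun setT f.
  apply/measurable_fun_tnthP => i _ B mB; apply: sub_sigma_algebra.
  exists (a i) => //; exists B => //; congr (_ `&` _).
  by apply/funext => w /=; rewrite tnth_mktuple.
by rewrite -[_ @^-1` _]setTI; exact: mf.
Qed.

Hypothesis UVW : independent3 P (sigma_rv U) (sigma_rv V) (sigma_field X W).

Let marginal_mfun : {mfun O >-> tupleR R q} :=
  HB.pack marginal (isMeasurableFun.Build _ _ _ _ _ measurable_marginal).

Let joint (w : O) : measurableTypeR R * (measurableTypeR R * tupleR R q) :=
  (U w, (V w, marginal w)).

Let mjoint : measurable_fun setT joint.
Proof.
apply: measurable_fun_pair; first exact: (measurable_funP U).
apply: measurable_fun_pair; first exact: (measurable_funP V).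
exact: measurable_marginal.
Qed.

Lemma prior_joint_law
    (S : set (measurableTypeR R * (measurableTypeR R * tupleR R q))) :
  measurable S ->
  P [set w | S (U w, (V w, marginal w))] =
  (\int[distribution P (borel_rv U)]_u \int[distribution P (borel_rv V)]_v
    P [set w | S (u, (v, marginal w))])%E.
Proof.
move=> mS.
rewrite -[LHS]/(image_measure P mjoint S).
rewrite (@triple_product_unique _ _ _ _ _ _ _ (distribution P (borel_rv U))
  (distribution P (borel_rv V)) (distribution P marginal_mfun)
  (image_measure P mjoint)) => //.
move=> A B C mA mB mC.
have -> : image_measure P mjoint (A `*` (B `*` C)) =
    P (U @^-1` A `&` V @^-1` B `&` marginal @^-1` C).
  by congr (P _); apply/seteqP; split => w /=; tauto.
rewrite UVW ?muleA//.
- by exists A => //; rewrite setTI.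
- by exists B => //; rewrite setTI.
- exact: sigma_field_marginal.
Qed.

End prior_law.

(** * The mixture is the density of the marginals of U + V W *)

Section prior_density_law.
Variable R : realType.
Local Notation leb := (@lebesgue_measure R).
Local Notation bR := (measurableTypeR R).

Lemma rV_of_affine q u v (t : tupleR R q) :
  rV_of (affine_tuple u v t) = const_mx u + v *: rV_of t.
Proof. by apply/rowP => i; rewrite !mxE tnth_map. Qed.

Lemma normal_density_kernS0 q (S : 'M[R]_q) z : posdefmx S ->
  normal_density 0 S z = kernS S z 1 0.
Proof.
move=> S_pd; rewrite -normal_density_kernS// expr1n scale1r.
by congr normal_density; apply/rowP => i; rewrite !mxE.
Qed.

(** The Jacobian v^q of the affine map cancels the v^-q of the kernel. *)
Lemma kernS_affine q (S : 'M[R]_q) z v u : 0 < v -> posdefmx S ->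
  v ^+ q * kernS S (const_mx u + v *: z) v u = normal_density 0 S z.
Proof.
move=> v0 S_pd; rewrite normal_density_kernS0// /kernS /kern.
rewrite -!invform_shift// [const_mx u + _]addrC addrK.
have -> : z - const_mx 0 = z by apply/rowP => i; rewrite !mxE subr0.
rewrite invformZl invformZr gtr0_norm// normr1 expr1n !expr1n invr1 !mulr1.
rewrite -[_ * v ^- q * _]mulrA [LHS]mulrCA [v ^+ q * _]mulrA.
rewrite mulfV ?gt_eqF ?exprn_gt0// mul1r.
by congr (_ * expR (- _)); field; rewrite gt_eqF.
Qed.

Lemma measurable_affine_joint q : measurable_fun setT
  (fun x : bR * (bR * tupleR R q) => affine_tuple x.1 x.2.1 x.2.2).
Proof.
apply/measurable_fun_tnthP => i.
rewrite (_ : _ \o _ =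
  fun x : bR * (bR * tupleR R q) => x.1 + x.2.1 * tnth x.2.2 i).
  apply: measurable_funD => //; apply: measurable_funM.
    exact: measurableT_comp.
  apply: (@measurableT_comp _ _ _ _ _ _ (fun t : tupleR R q => tnth t i)).
    exact: measurable_tnth.
  exact: measurableT_comp.
by apply/funext => x /=; rewrite tnth_map.
Qed.

Lemma integral_kernS_affine q (S : 'M[R]_q) (A : set (tupleR R q)) u v :
  measurable A -> 0 < v -> posdefmx S ->
  (\int[lebesgue_tuple q]_(t in A) (kernS S (rV_of t) v u)%:E =
   \int[lebesgue_tuple q]_(t in affine_tuple u v @^-1` A)
     (normal_density 0 S (rV_of t))%:E)%E.
Proof.
move=> mA v0 S_pd; rewrite [LHS]integral_mkcond [RHS]integral_mkcond.
have mk : measurable_fun setT (fun t : tupleR R q => (kernS S (rV_of t) v u)%:E).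
  by apply: measurable_kernS => // i; exact: measurable_rV_of.
rewrite (ge0_integral_affine_tuple u v0); last 2 first.
- by apply/(measurable_restrictT _ mA); exact: measurable_funTS.
- by move=> t; rewrite patchE; case: ifP => // _; rewrite lee_fin kernS_ge0.
have maff := measurable_affine_tuple u v (q := q).
rewrite -ge0_integralZl//; last 3 first.
- apply: (@measurableT_comp _ _ _ _ _ _ ((fun t => (kernS S (rV_of t) v u)%:E) \_ A)) => //.
  by apply/(measurable_restrictT _ mA); exact: measurable_funTS.
- by move=> t _; rewrite patchE; case: ifP => // _; rewrite lee_fin kernS_ge0.
- by rewrite lee_fin exprn_ge0// ltW.
apply: eq_integral => t _; rewrite !patchE.
have -> : (t \in affine_tuple u v @^-1` A) = (affine_tuple u v t \in A).
  by apply/idP/idP; rewrite !inE.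
case: ifPn => _; last by rewrite mule0.
by rewrite rV_of_affine -EFinM kernS_affine.
Qed.

Section law.
Variables (D : nat) (X : set 'rV[R]_D) (k : 'rV[R]_D -> 'rV[R]_D -> R).
Variables (d : measure_display) (O : measurableType d) (P : probability O R).
Variables (U V : {RV P >-> R}) (W : 'rV[R]_D -> {RV P >-> R}).
Variables (m e : R) (q : nat) (a : 'I_q -> 'rV[R]_D).
Hypotheses (m_gt0 : 0 < m) (e_gt0 : 0 < e) (e_lt1 : e < 1).
Hypotheses (model : prior_model X k m e U V W) (aX : forall i, X (a i)).
Hypothesis S_pd : posdefmx (corr_mx k a a).
Let S := corr_mx k a a.
Local Notation lam := (@lebesgue_tuple R q).

Lemma integral_uniform_rv (Z : {RV P >-> R}) (l r : R) (f : bR -> \bar R) :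
  uniform_rv Z l r -> measurable_fun setT f -> (forall x, 0 <= f x)%E ->
  (\int[distribution P (borel_rv Z)]_x f x =
   (r - l)^-1%:E * \int[leb]_(x in `[l, r]) f x)%E.
Proof.
move=> [lr Zlr] mf f0.
rewrite (eq_measure_integral (uniform_prob lr)); first by rewrite integral_uniform.
by move=> B mB _; exact: Zlr.
Qed.

Lemma prior_field_law (A : set (tupleR R q)) : measurable A ->
  P [set w | A (mktuple (fun i => prior_field U V W (a i) w))] =
  (\int[lam]_(t in A) (prior_density m e S (rV_of t))%:E)%E.
Proof.
move=> mA; have [Um Ve [_ _ W_law] indep] := model.
pose E : set (bR * (bR * tupleR R q)) :=
  (fun x => affine_tuple x.1 x.2.1 x.2.2) @^-1` A.
have mE : measurable E.
  by rewrite -[E]setTI; exact: measurable_affine_joint.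
rewrite [X in P X](_ : _ = [set w | E (U w, (V w, marginal W a w))]); last first.
  apply/seteqP; split => w; rewrite /E /=;
    set t1 := mktuple _; set t2 := affine_tuple _ _ _; (suff -> : t1 = t2 by []);
    apply: eq_from_tnth => i;
    by rewrite /t1 /t2 [RHS]tnth_map !tnth_mktuple.
rewrite (prior_joint_law aX indep mE).
have [_ _ W_dens] := W_law q a aX S_pd.
pose G (uv : bR * bR) := P [set w | E (uv.1, (uv.2, marginal W a w))].
(* For fixed u and v > 0 the event says that the marginal of W lies in the preimage of A under the
   affine map; the law of V charges only v >= e. *)
have GE u v : 0 < v -> G (u, v) = (\int[lam]_(t in A) (kernS S (rV_of t) v u)%:E)%E.
  move=> v0; rewrite integral_kernS_affine// -W_dens//.
  by rewrite -[_ @^-1` _]setTI; exact: measurable_affine_tuple.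
have mG : measurable_fun setT G.
  pose g (uv : bR * bR) w : \bar R := (\1_E (uv.1, (uv.2, marginal W a w)))%:E.
  have mg : measurable_fun setT (fun x => g x.1 x.2).
    apply/measurable_EFinP.
    apply: (@measurableT_comp _ _ _ _ _ _ (\1_E : _ -> R) setT
      (fun x : (bR * bR) * O => (x.1.1, (x.1.2, marginal W a x.2)))).
      exact: measurable_indic.
    apply: measurable_fun_pair; first exact: measurableT_comp.
    apply: measurable_fun_pair; first exact: measurableT_comp.
    by apply: measurableT_comp => //; exact: measurable_marginal.
  have g0 x y : (0 <= g x y)%E by rewrite lee_fin.
  have := @measurable_fun_integral_section _ _ _ _ R P g setT measurableT mg g0.
  apply: eq_measurable_fun => uv _.
  pose H := [set w | E (uv.1, (uv.2, marginal W a w))].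
  have mH : measurable H.
    pose h w : bR * (bR * tupleR R q) := (uv.1, (uv.2, marginal W a w)).
    have mh : measurable_fun setT h.
      by do 2 apply: measurable_fun_pair => //; exact: measurable_marginal.
    by rewrite -[H]setTI; exact: mh.
  have -> : G uv = (\int[P]_w (\1_H w)%:E)%E by rewrite integral_indic// setIT.
  by apply: eq_integral => w _; rewrite /g !indicE.
have mGu u : measurable_fun setT (fun v : bR => G (u, v)).
  exact: measurable_fun_pair2.
have I1 u : (\int[distribution P (borel_rv V)]_v G (u, v) = (e^-1 - e)^-1%:E *
    \int[leb]_(v in `[e, e^-1%R]) \int[lam]_(t in A) (kernS S (rV_of t) v u)%:E)%E.
  rewrite (integral_uniform_rv Ve)//; congr (_ * _)%E.
  apply: eq_integral => v; rewrite inE/= in_itv/= => /andP[ev _].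
  by rewrite GE// (lt_le_trans e_gt0).
under eq_integral do rewrite I1.
(* Joint measurability in (u, v, t), of which the exchanges below use sections and reorderings. *)
have mk4 (f : bR * bR * tupleR R q -> \bar R) :
  f = (fun x => (kernS S (rV_of x.2) x.1.2 x.1.1)%:E) -> measurable_fun setT f.
  move=> ->; apply: measurable_kernS.
  - move=> i.
    apply: (@measurableT_comp _ _ _ _ _ _ (fun t : tupleR R q => rV_of t 0 i)) => //.
    exact: measurable_rV_of.
  - exact: measurableT_comp.
  - exact: measurableT_comp.
pose f3 (u v : bR) (t : tupleR R q) := (kernS S (rV_of t) v u)%:E.
have f3_ge0 u v t : (0 <= f3 u v t)%E by rewrite lee_fin kernS_ge0.
have mA_uv : measurable_fun setT (fun uv : bR * bR => \int[lam]_(t in A) f3 uv.1 uv.2 t)%E.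
  apply: (@measurable_fun_integral_section _ _ _ _ R lam
    (fun (uv : bR * bR) t => f3 uv.1 uv.2 t)) => //.
  exact: (mk4 _ erefl).
have mJ : measurable_fun setT (fun u : bR =>
    \int[leb]_(v in `[e, e^-1%R]) \int[lam]_(t in A) f3 u v t)%E.
  apply: (@measurable_fun_integral_section _ _ _ _ R leb
    (fun u v => \int[lam]_(t in A) f3 u v t)%E) => //.
  by move=> u v; exact: integral_ge0.
have J0 u : (0 <= \int[leb]_(v in `[e, e^-1%R]) \int[lam]_(t in A) f3 u v t)%E.
  by do 2 apply: integral_ge0 => ? _.
have e0 : 0 < e^-1 - e by rewrite subr_gt0 (lt_trans e_lt1)// invf_gt1.
have ce0 : (0 <= ((e^-1 - e)^-1)%:E)%E by rewrite lee_fin invr_ge0 ltW.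
rewrite (integral_uniform_rv Um); last 2 first.
- by apply: measurable_funeM; exact: mJ.
- by move=> u; exact: (mule_ge0 ce0 (J0 u)).
rewrite ge0_integralZl//; last 2 first.
- exact: (measurable_funTS mJ).
- by move=> u _; exact: J0.
rewrite opprK (_ : m + m = 2 * m); last by rewrite mulr_natl mulr2n.
(* Three exchanges bring t outermost: the order of integration (u, v, t) becomes (u, t, v), then (t,
   u, v), then (t, v, u). *)
transitivity (((2 * m)^-1 * (e^-1 - e)^-1)%:E * \int[lam]_(t in A) mix S (rV_of t) m e)%E.
  rewrite muleA -EFinM; congr (_ * _)%E.
  transitivity (\int[leb]_(u in `[(- m)%R, m%R]) \int[lam]_(t in A)
      \int[leb]_(v in `[e, e^-1%R]) f3 u v t)%E.
    apply: eq_integral => u _.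
    apply: (@tonelli_sets _ _ _ _ R leb lam (f3 u)) => //.
    apply: (@measurableT_comp _ _ _ _ _ _
      (fun x : bR * bR * tupleR R q => f3 x.1.1 x.1.2 x.2) setT
      (fun x : bR * tupleR R q => ((u, x.1), x.2))); first exact: (mk4 _ erefl).
    by do 2 apply: measurable_fun_pair => //.
  transitivity (\int[lam]_(t in A) \int[leb]_(u in `[(- m)%R, m%R])
      \int[leb]_(v in `[e, e^-1%R]) f3 u v t)%E.
    apply: (@tonelli_sets _ _ _ _ R leb lam
      (fun u t => \int[leb]_(v in `[e, e^-1%R]) f3 u v t)%E) => [|||u t].
    - exact: measurable_itv.
    - exact: mA.
    - apply: (@measurable_fun_integral_section _ _ (bR * tupleR R q)%type _ R leb
        (fun ut v => f3 ut.1 v ut.2)) => [||ut v].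
      + exact: measurable_itv.
      + apply: (@measurableT_comp _ _ _ _ _ _
          (fun x : bR * bR * tupleR R q => f3 x.1.1 x.1.2 x.2) setT
          (fun x : (bR * tupleR R q) * bR => ((x.1.1, x.2), x.1.2))).
          exact: (mk4 _ erefl).
        apply: measurable_fun_pair; last exact: measurableT_comp.
        by apply: measurable_fun_pair => //; exact: measurableT_comp.
      + exact: f3_ge0.
    - by apply: integral_ge0 => v _; exact: f3_ge0.
  apply: eq_integral => t _.
  apply: (@tonelli_sets _ _ _ _ R leb leb (fun u v => f3 u v t)) => //.
  apply: (@measurableT_comp _ _ _ _ _ _
      (fun x : bR * bR * tupleR R q => f3 x.1.1 x.1.2 x.2) setT
      (fun x : bR * bR => (x, t))); first exact: (mk4 _ erefl).
  exact: measurable_fun_pair.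
have c0 : 0 <= (2 * m)^-1 * (e^-1 - e)^-1.
  by rewrite mulr_ge0// invr_ge0 ?mulr_ge0// ltW.
rewrite -ge0_integralZl//.
- by apply: eq_integral => t _; rewrite prior_densityE// [RHS]EFinM fineK// mix_fin.
- apply: measurable_funTS; apply: measurable_mix => // i; exact: measurable_rV_of.
- by move=> t _; exact: mix_ge0.
Qed.

Lemma prior_density_ge0 z : 0 <= prior_density m e S z.
Proof.
rewrite prior_densityE// mulr_ge0 ?fine_ge0 ?mix_ge0//.
by rewrite mulr_ge0// invr_ge0 ?mulr_ge0 ?(ltW m_gt0)// subr_ge0 ltW//
  (lt_trans e_lt1)// invf_gt1.
Qed.

Lemma prior_density_gt0 z : 0 < prior_density m e S z.
Proof.
rewrite prior_densityE// mulr_gt0//; last first.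
  by rewrite fine_gt0// mix_gt0// ltey_eq mix_fin.
by rewrite mulr_gt0// invr_gt0 ?mulr_gt0// subr_gt0 (lt_trans e_lt1)// invf_gt1.
Qed.

Lemma prior_has_density :
  has_density P (fun i => prior_field U V W (a i)) (prior_density m e S).
Proof.
split; [|exact: prior_density_ge0|exact: prior_field_law].
rewrite (_ : _ \o _ = fun t => (2 * m)^-1 * (e^-1 - e)^-1 * fine (mix S (rV_of t) m e)).
  apply: measurable_funM => //.
  apply: (@measurableT_comp _ _ _ _ _ _ (@fine R)) => //.
  by apply: measurable_mix => // i; exact: measurable_rV_of.
by apply/funext => t /=; rewrite prior_densityE.
Qed.
End law.
End prior_density_law.

(** * Continuity of the prior densities *)

Section continuity.
Variable R : realType.
Local Notation leb := (@lebesgue_measure R).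
Local Notation one := (const_mx 1).

(** One-sided Lipschitz bound; for a < b it follows from exp (a - b) >= 1 + (a - b) and exp (- a) <=
    1. *)
Lemma expRN_le_add_dist (a b : R) : 0 <= a -> expR (- a) <= expR (- b) + `|a - b|.
Proof.
move=> a0; have [ba|ab] := leP b a.
  by rewrite (@le_trans _ _ (expR (- b))) ?ler_expR ?lerN2// lerDl.
have -> : expR (- b) = expR (- a) * expR (a - b) by rewrite -expRD addrA addNr add0r.
have E1 : expR (- a) <= 1 by rewrite expR_le1 oppr_le0.
have E2 : 1 + (a - b) <= expR (a - b) by exact: expR_ge1Dx.
have E0 : 0 <= expR (- a) by exact: expR_ge0.
by rewrite ltr0_norm ?subr_lt0//; nra.
Qed.

Lemma ler_scaled_sandwich (c x y dl : R) : 0 <= c -> x <= y + dl -> y <= x + dl ->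
  c * x - c * dl <= c * y <= c * x + c * dl.
Proof.
by move=> c0 xy yx; rewrite lerBlDr -!mulrDr !ler_wpM2l.
Qed.

Lemma fine_leD (x y : \bar R) (c : R) : x \is a fin_num -> y \is a fin_num ->
  (x <= y + c%:E)%E -> fine x <= fine y + c.
Proof. by case: x y => [x||] [y||]. Qed.

Section fixed.
Variables (q : nat) (S : 'M[R]_q) (m e : R).
Hypotheses (S_pd : posdefmx S) (m_gt0 : 0 < m) (e_gt0 : 0 < e) (e_lt1 : e < 1).

(** Bounds the variation of the exponent's numerator between z and z' uniformly in |u| <= m; the
    term in u^2 does not depend on z. *)
Let gap (z z' : 'rV[R]_q) : R :=
  `|invform S z z - invform S z' z'| +
  2 * m * `|invform S z one - invform S z' one|.

(** Product of the largest prefactor of the kernel and the largest value of 1 / (2 v^2), both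
    attained at v = e. *)
Let lip : R := kern_const S * e ^- q / (2 * e ^+ 2).

Let lip_ge0 : 0 <= lip.
Proof.
by rewrite divr_ge0 ?mulr_ge0 ?invr_ge0 ?exprn_ge0 ?(ltW e_gt0) ?(ltW (kern_const_gt0 _)).
Qed.

Let gap_ge0 z z' : 0 <= gap z z'.
Proof. by rewrite addr_ge0// !mulr_ge0// ltW. Qed.

Lemma kernS_le_add z z' v u : e <= v -> `|u| <= m ->
  kernS S z v u <= kernS S z' v u + lip * gap z z'.
Proof.
move=> ev um; have v0 := lt_le_trans e_gt0 ev.
rewrite /kernS /kern.
set Q := invform S z z; set Q' := invform S z' z'.
set B := invform S z one; set B' := invform S z' one; set c := invform S one one.
pose a := (Q - 2 * u * B + u ^+ 2 * c) / (2 * v ^+ 2).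
pose b := (Q' - 2 * u * B' + u ^+ 2 * c) / (2 * v ^+ 2).
have a0 : 0 <= a.
  by rewrite /a -invform_shift// divr_ge0 ?invform_ge0// mulr_ge0// exprn_ge0// ltW.
have K0 := ltW (kern_const_gt0 S_pd).
apply: (@le_trans _ _ (kern_const S * `|v| ^- q * (expR (- b) + `|a - b|))).
  by rewrite ler_wpM2l ?expRN_le_add_dist// mulr_ge0// invr_ge0 exprn_ge0.
rewrite mulrDr lerD2l.
have Kle : kern_const S * `|v| ^- q <= kern_const S * e ^- q.
  rewrite ler_wpM2l// lef_pV2 ?posrE ?exprn_gt0 ?normr_gt0 ?gt_eqF//.
  by rewrite lerXn2r ?nnegrE ?(ltW e_gt0)// gtr0_norm.
have ab_le : `|a - b| <= gap z z' / (2 * e ^+ 2).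
  rewrite /a /b -mulrBl normrM [X in _ * X]gtr0_norm; last first.
    by rewrite invr_gt0 mulr_gt0// exprn_gt0.
  apply: ler_pM => //; first by rewrite invr_ge0 mulr_ge0// exprn_ge0// ltW.
    have -> : Q - 2 * u * B + u ^+ 2 * c - (Q' - 2 * u * B' + u ^+ 2 * c) =
      (Q - Q') - 2 * u * (B - B') by ring.
    rewrite (le_trans (ler_normB _ _))// lerD2l !normrM ger0_norm//.
    by rewrite -!mulrA ler_pM2l// ler_wpM2r.
  rewrite lef_pV2 ?posrE ?mulr_gt0 ?exprn_gt0// ler_pM2l//.
  by rewrite lerXn2r ?nnegrE ?(ltW e_gt0) ?(ltW v0).
rewrite /lip -[leRHS]mulrA [_^-1 * gap _ _]mulrC; apply: ler_pM => //.
by rewrite mulr_ge0// invr_ge0 exprn_ge0.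
Qed.

Let area : R := (m - - m) * (e^-1 - e).

Lemma mix_le_add z z' :
  (mix S z m e <= mix S z' m e + (lip * gap z z' * area)%:E)%E.
Proof.
pose dl := lip * gap z z'.
have dl0 : 0 <= dl by exact: mulr_ge0.
have mm : - m < m by rewrite gtrN.
have ee : e < e^-1 by rewrite (lt_trans e_lt1)// invf_gt1.
have mk z1 v : measurable_fun setT (fun u : measurableTypeR R => (kernS S z1 v u)%:E).
  exact: measurable_kernS.
have mI z1 : measurable_fun setT (fun v : measurableTypeR R =>
    \int[leb]_(u in `[(- m)%R, m%R]) (kernS S z1 v u)%:E)%E.
  apply: (@measurable_fun_integral_section _ _ _ _ R leb
    (fun v u => (kernS S z1 v u)%:E)) => [||v u].
  - exact: measurable_itv.
  - exact: measurable_kernS.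
  - by rewrite lee_fin kernS_ge0.
have I0 z1 v : (0 <= \int[leb]_(u in `[(- m)%R, m%R]) (kernS S z1 v u)%:E)%E.
  by apply: integral_ge0 => u _; rewrite lee_fin kernS_ge0.
have Iu v : e <= v ->
  (\int[leb]_(u in `[(- m)%R, m%R]) (kernS S z v u)%:E <=
   \int[leb]_(u in `[(- m)%R, m%R]) (kernS S z' v u)%:E + (dl * (m - - m))%:E)%E.
  move=> ev.
  have -> : (dl * (m - - m))%:E = (\int[leb]_(u in `[(- m)%R, m%R]) dl%:E)%E.
    by rewrite integral_cst//= lebesgue_measure_itv/= lte_fin mm -EFinB -EFinM.
  rewrite -ge0_integralD//; last 2 first.
  - by move=> u _; rewrite lee_fin kernS_ge0.
  - exact: measurable_funTS.
  apply: ge0_le_integral => //.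
  - by move=> u _; rewrite lee_fin kernS_ge0.
  - exact: measurable_funTS.
  - by apply: emeasurable_funD => //; exact: measurable_funTS.
  - move=> u /=; rewrite in_itv/= => um; rewrite -EFinD lee_fin kernS_le_add//.
    by rewrite ler_norml.
rewrite /mix /area mulrA -/dl.
have -> : (dl * (m - - m) * (e^-1 - e))%:E =
    (\int[leb]_(v in `[e, e^-1%R]) (dl * (m - - m))%:E)%E.
  by rewrite integral_cst//= lebesgue_measure_itv/= lte_fin ee -EFinB -EFinM.
have dm0 : 0 <= dl * (m - - m) by rewrite mulr_ge0// subr_ge0 ltW.
rewrite -ge0_integralD//; last exact: (measurable_funTS (mI z')).
apply: ge0_le_integral.
- exact: measurable_itv.
- by move=> v _; exact: I0.
- exact: (measurable_funTS (mI z)).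
- by apply: emeasurable_funD => //; exact: (measurable_funTS (mI z')).
- by move=> v /=; rewrite in_itv/= => /andP[ev _]; exact: Iu.
Qed.

Lemma continuous_invform (f g : 'rV[R]_q -> 'rV[R]_q) :
  continuous f -> continuous g -> continuous (fun z => invform S (f z) (g z)).
Proof.
move=> cf cg.
have coordC (h : 'rV[R]_q -> 'rV[R]_q) i : continuous h -> continuous (fun z => h z 0 i).
  move=> ch z; exact: (cvg_comp _ _ (ch z) (@coord_continuous R 1 q 0 i (h z))).
have termC i j : continuous (fun z => f z 0 i * invmx S i j).
  by move=> z; exact: (cvgM (coordC f i cf z) (cvg_cst _)).
have sumC j : continuous (fun z => \sum_i f z 0 i * invmx S i j).
  by apply: continuous_big => //; exact: add_continuous.
have prodC j : continuous (fun z => (\sum_i f z 0 i * invmx S i j) * g z 0 j).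
  by move=> z; exact: (cvgM (sumC j z) (coordC g j cg z)).
rewrite (_ : (fun z => _) =
  fun z => \sum_j (\sum_i f z 0 i * invmx S i j) * g z 0 j).
  by apply: continuous_big => //; exact: add_continuous.
apply/funext => x; rewrite /invform mxE; apply: eq_bigr => j _.
by rewrite !mxE.
Qed.

(** The bound of [mix_le_add], applied in both directions since [gap] is symmetric, encloses the
    density between its value at z and an error that vanishes as z' tends to z. *)
Lemma continuous_prior_density : continuous (prior_density m e S : 'rV[R]_q -> R).
Proof.
move=> z.
pose C := (2 * m)^-1 * (e^-1 - e)^-1.
have ee : 0 < e^-1 - e by rewrite subr_gt0 (lt_trans e_lt1)// invf_gt1.
have C0 : 0 <= C by rewrite mulr_ge0// invr_ge0 ?mulr_ge0// ltW.
have fle z1 z2 : fine (mix S z1 m e) <= fine (mix S z2 m e) + lip * gap z1 z2 * area.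
  apply: fine_leD; first exact: mix_fin.
    exact: mix_fin.
  exact: mix_le_add.
have gapC z1 z2 : gap z1 z2 = gap z2 z1 by rewrite /gap distrC [X in _ * X]distrC.
pose w z' := C * (lip * gap z' z * area).
have bnd z' : prior_density m e S z - w z' <= prior_density m e S z' <=
    prior_density m e S z + w z'.
  have pE z1 : prior_density m e S z1 = C * fine (mix S z1 m e).
    exact: prior_densityE.
  rewrite (pE z) (pE z'); apply: (ler_scaled_sandwich C0 _ (fle z' z)).
  by rewrite (gapC z' z); exact: (fle z z').
have dist0 (f : 'rV[R]_q -> R) : continuous f -> `|f z' - f z| @[z' --> z] --> (0 : R).
  move=> cf; rewrite -(@normr0 _ R) -(subrr (f z)).
  exact: (cvg_norm (cvgB (cf z) (cvg_cst (f z)))).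
have cQ : continuous (fun z' : 'rV[R]_q => invform S z' z').
  by apply: continuous_invform => ?.
have cB : continuous (fun z' : 'rV[R]_q => invform S z' one).
  have c1 : continuous (fun _ : 'rV[R]_q => one : 'rV[R]_q) by exact: cst_continuous.
  by apply: (continuous_invform _ c1) => ?.
have cg : gap z' z @[z' --> z] --> (0 : R).
  have := cvgD (dist0 _ cQ) (cvgM (cvg_cst (2 * m)) (dist0 _ cB)).
  by rewrite mulr0 addr0; exact.
have cw : w z' @[z' --> z] --> (0 : R).
  have := cvgM (cvg_cst C) (cvgM (cvgM (cvg_cst lip) cg) (cvg_cst area)).
  by rewrite mulr0 mul0r mulr0; exact.
have lo : prior_density m e S z - w z' @[z' --> z] --> prior_density m e S z - 0.
  exact: (cvgB (cvg_cst _) cw).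
have hi : prior_density m e S z + w z' @[z' --> z] --> prior_density m e S z + 0.
  exact: (cvgD (cvg_cst _) cw).
rewrite subr0 in lo; rewrite addr0 in hi.
exact: (squeeze_cvgr (nearW _ bnd) lo hi).
Qed.

End fixed.
End continuity.

(** * Posterior densities *)

Section posterior.
Variables (R : realType) (D : nat) (k : 'rV[R]_D -> 'rV[R]_D -> R).
Local Notation point := 'rV[R]_D.

Lemma corr_mx_cat p n (a : 'I_p -> point) (b : 'I_n -> point) :
  corr_mx k (cat_pts a b) (cat_pts a b) =
  block_mx (corr_mx k a a) (corr_mx k a b) (corr_mx k b a) (corr_mx k b b).
Proof.
apply/matrixP => i j; rewrite -(splitK i) -(splitK j) mxE /cat_pts !unsplitK.
by case: (fintype.split i) (fintype.split j) => i' [] j' /=;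
  rewrite ?(block_mxEul, block_mxEur, block_mxEdl, block_mxEdr) mxE.
Qed.

(** Symmetry of k is not assumed; positive definiteness of the full matrix forces the off-diagonal
    blocks to be transposes. *)
Lemma corr_mx_cat_posdef p n (a : 'I_p -> point) (b : 'I_n -> point) :
  posdefmx (corr_mx k (cat_pts a b) (cat_pts a b)) ->
  corr_mx k (cat_pts a b) (cat_pts a b) =
  block_mx (corr_mx k a a) (corr_mx k a b) (corr_mx k a b)^T (corr_mx k b b).
Proof.
rewrite corr_mx_cat => -[+ _]; rewrite tr_block_mx => /eq_block_mx[_ _ + _].
by move=> ->.
Qed.

Variables (p n : nat) (xs : 'I_n -> point) (y : 'rV[R]_n) (a : 'I_p -> point).
Hypotheses (n_ge3 : (3 <= n)%N) (y_nonconst : ~ exists c : R, y = const_mx c).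
Hypothesis T_pd : posdefmx (corr_mx k (cat_pts a xs) (cat_pts a xs)).
Let A := corr_mx k a a.
Let B := corr_mx k a xs.
Let C := corr_mx k xs xs.

Lemma posterior_becomes_student :
  becomes_student (posterior_density k xs y a) (n - 2)
    (post_loc B C y) (student_scale (n - 2) A B C y).
Proof.
have TE := corr_mx_cat_posdef T_pd.
have T_pd' : posdefmx (block_mx A B B^T C) by rewrite -TE.
have n2 : (0 < n - 2)%N by rewrite subn_gt0.
have nE : n = (n - 2).+2 by rewrite -[in LHS](subnK (ltnW n_ge3)) addn2.
split=> //; first exact: student_scale_posdef.
- by move=> t; rewrite /posterior_density TE; exact: post_cvg.
- by move=> S mS; rewrite /posterior_density TE; exact: post_set_cvg.
Qed.

End posterior.

(** * Kriging formulae at a single point *)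

Section univariate.
Variables (R : realType) (D : nat) (k : 'rV[R]_D -> 'rV[R]_D -> R).
Variables (n : nat) (xs : 'I_n -> 'rV[R]_D) (y : 'rV[R]_n) (x : 'rV[R]_D).
Hypotheses (n_ge3 : (3 <= n)%N) (y_nonconst : ~ exists c : R, y = const_mx c).
Hypothesis kxx : k x x = 1.
Local Notation ax := (fun _ : 'I_1 => x).
Hypothesis T_pd : posdefmx (corr_mx k (cat_pts ax xs) (cat_pts ax xs)).
Let A := corr_mx k ax ax.
Let B := corr_mx k ax xs.
Let C := corr_mx k xs xs.
Let kx : 'rV[R]_n := \row_j k x (xs j).
Local Notation one := (const_mx 1).

Let BE : B = kx. Proof. by apply/matrixP => i j; rewrite !mxE. Qed.

Let T_pd' : posdefmx (block_mx A B B^T C).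
Proof. by rewrite -corr_mx_cat_posdef. Qed.

Let C_pd := posdef_dr T_pd'.

Let subE (M N : 'M[R]_1) : (M - N) 0 0 = M 0 0 - N 0 0.
Proof. by rewrite !mxE. Qed.

Let schur_rowE t s : schur_row B C t s = (t 0 0 - invform C s kx)%:M.
Proof. by rewrite [LHS]mx11_scalar /schur_row BE subE. Qed.

Lemma post_loc_krig : post_loc B C y = (krig_loc k xs y x)%:M.
Proof.
have [Ct _] := C_pd.
rewrite /post_loc !schur_rowE scale_scalar_mx -raddfD /=; congr (_%:M).
rewrite !mxE /krig_loc /krig_mean -/C -/kx.
rewrite !(invformDr, invformNr, invformNl, invformZr) (invformC kx)//.
by rewrite [invform C kx one]invformC//; ring.
Qed.

Lemma student_scale_krig :
  student_scale (n - 2) A B C y = (krig_scale k xs y x ^+ 2)%:M.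
Proof.
have n0 : (0 < n)%N by rewrite (leq_trans _ n_ge3).
have n2 : (0 < n - 2)%N by rewrite subn_gt0.
pose s := (n - 2)%:R^-1 * residual C y *
   (1 - invform C kx kx + (1 - invform C one kx) ^+ 2 / invform C one one).
have sE : student_scale (n - 2) A B C y = s%:M.
  rewrite [LHS]mx11_scalar; congr (_%:M).
  rewrite /student_scale /post_scale /rank1_update schur_rowE /schur BE.
  rewrite tr_scalar_mx -scalar_mxM scale_scalar_mx.
  have E (M N : 'M[R]_1) c b : (c *: (M - N + b%:M)) 0 0 = c * (M 0 0 - N 0 0 + b).
    by rewrite !mxE eqxx mulr1n.
  rewrite E /s ![const_mx 1 0 0]mxE /A mxE kxx mulrC.
  by rewrite -/(invform C kx kx) [_%:R^-1 * _]mulrC [X in _ * X]mulrC expr2; ring.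
(* [krig_scale] is a square root, so its square is the radicand only once that is nonnegative; here
   s is the determinant of a positive definite 1 x 1 matrix. *)
have s_gt0 : 0 < s.
  have S_pd : posdefmx (student_scale (n - 2) A B C y).
    by apply: student_scale_posdef => //; rewrite -[LHS](subnK (ltnW n_ge3)) addn2.
  by have := posdef_det_gt0 S_pd; rewrite sE det_scalar1.
have sqE : krig_scale k xs y x ^+ 2 = s.
  rewrite /krig_scale -residualE// -/(krig_mean _ _ _).
  by rewrite sqr_sqrtr ?(ltW s_gt0).
by rewrite sE sqE.
Qed.

End univariate.

(** The exclusion of degenerate cases takes two forms: y is not constant, which keeps the residual
    positive, and the correlation matrix of new and observed points together is positive definite,
    which in particular keeps the new points distinct from the observed ones. *)
Theorem theorem3 (R : realType) (D : nat) (X : set 'rV[R]_D)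
    (k : 'rV[R]_D -> 'rV[R]_D -> R) (n : nat) (xs : 'I_n -> 'rV[R]_D)
    (y : 'rV[R]_n)
    (n_ge3 : (3 <= n)%N)
    (k_diag : forall x, X x -> k x x = 1)
    (xs_X : forall i, X (xs i))
    (Sigma_posdef : posdefmx (corr_mx k xs xs))
    (y_nonconst : ~ exists c : R, y = const_mx c) :
  [/\ forall (p : nat) (a : 'I_p -> 'rV[R]_D), (forall i, X (a i)) ->
        posdefmx (corr_mx k (cat_pts a xs) (cat_pts a xs)) ->
        forall m e : R, 0 < m -> 0 < e -> e < 1 ->
        forall (d : measure_display) (O : measurableType d)
          (P : probability O R) (U V : {RV P >-> R})
          (W : 'rV[R]_D -> {RV P >-> R}),
        prior_model X k m e U V W ->
        cond_density P (prior_field U V W) a xs y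
          (posterior_density k xs y a m e),
      forall (p : nat) (a : 'I_p -> 'rV[R]_D), (forall i, X (a i)) ->
        posdefmx (corr_mx k (cat_pts a xs) (cat_pts a xs)) ->
        exists (loc : 'rV[R]_p) (S : 'M[R]_p),
          becomes_student (posterior_density k xs y a) (n - 2) loc S
    & forall x : 'rV[R]_D, X x ->
        posdefmx (corr_mx k (cat_pts (fun _ : 'I_1 => x) xs)
                            (cat_pts (fun _ : 'I_1 => x) xs)) ->
        becomes_student (posterior_density k xs y (fun _ : 'I_1 => x))
          (n - 2) (krig_loc k xs y x)%:M ((krig_scale k xs y x) ^+ 2)%:M].
Proof.
split.
- move=> p a aX T_pd m e m0 e0 e1 d O P U V W model.
  exists (prior_density m e (corr_mx k (cat_pts a xs) (cat_pts a xs))).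
  exists (prior_density m e (corr_mx k xs xs)).
  have catX i : X (cat_pts a xs i) by rewrite /cat_pts; case: fintype.split.
  split.
  + split; first exact: continuous_prior_density.
    exact: (prior_has_density m0 e0 e1 model catX T_pd).
  + split; first exact: continuous_prior_density.
    exact: (prior_has_density m0 e0 e1 model xs_X Sigma_posdef).
  + exact: prior_density_gt0.
  + by [].
- move=> p a aX T_pd; eexists; eexists; exact: posterior_becomes_student.
- move=> x xX T_pd.
  rewrite -(post_loc_krig _ T_pd) -(student_scale_krig n_ge3 y_nonconst (k_diag _ xX) T_pd).
  exact: posterior_becomes_student.
Qed.
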